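(* Let $1<p<\infty$, $1/p+1/p'=1$, $-\frac1p<\gamma<1-\frac1p$, and let $d=(d_n)_{n\ge 0}$ be a strictly increasing sequence of positive integers with $d_0=1$. Let $g=(g_k)_{k\ge1}$ be a complex sequence. For every $K\in\mathbb N$, every $a=(a_n)\in\ell^p$ with $a_n\ge 0$ for all $n\in\mathbb N$, and every sequence $\hat g$ with $G(n;d;\hat g)=1$ for all $n\in\mathbb N$, $$ C_K(g;a)\le \sup_{j\ge K}\left[ G(j;d;g)^{\frac1p}\max\left\{\left(\frac{d_j}{d_{j-1}}\right)^{1-\gamma},\left(\frac{d_j}{d_{j-1}}\right)^{\gamma}\right\}\right] C_K(\hat g;a), $$ and for every $K\in\mathbb N$, $$ \sup_{\|a\|_{\ell^p}=1} C_K(g;a)\ \ge\ \sup_{j\ge K}\left[G(j;d;g)^{\frac1p}\left(\frac{d_j-d_{j-1}}{d_j}\right)^{\frac1p}\right]\left(\int_3^\infty \frac{x^{-|\gamma|p'}}{(1+x)^{p'}}\,dx\right)^{\frac1{p'}} . $$ Moreover: (1) The implication ''for every sequence $g$: if $\sup_n G(n;d;g)<\infty$, then $H_{g,\gamma}$ is bounded on $\ell^p$'' holds if and only if $\sup_{j\ge1} d_j/d_{j-1}<\infty$. (2) The implication ''for every sequence $g$: if $H_{g,\gamma}$ is bounded on $\ell^p$, then $\sup_n G(n;d;g)<\infty$'' holds if and only if $\inf_{j\ge1} d_j/d_{j-1}>1$.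
   Context: Sequences are complex and indexed by $\mathbb N=\{1,2,\dots\}$ (except $d$, which is indexed from $0$). For a sequence $g=(g_k)$ and $n\in\mathbb N$, $$G(n;d;g):=\frac1{d_n-d_{n-1}}\sum_{k=d_{n-1}}^{d_n-1}|g_k|^p .$$ The operator $H_{g,\gamma}$ maps $a=(a_n)\in\ell^p$ to the sequence whose $k$-th entry ($k\in\mathbb N$) is $$\sum_{n=1}^\infty \left(\frac kn\right)^\gamma\frac{g_k a_n}{n+k};$$ it is said to be bounded on $\ell^p$ if it is a bounded operator $\ell^p\to\ell^p$. For $K\in\mathbb N$ and $a\in\ell^p$, $$C_K(g;a):=\left(\sum_{k=d_{K-1}}^\infty\left|\sum_{n=1}^\infty\left(\frac kn\right)^\gamma\frac{a_n g_k}{n+k}\right|^p\right)^{\frac1p}\in[0,\infty].$$ *)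

(* Defs.v *)
From mathcomp Require Import all_boot all_order all_algebra.
From mathcomp Require Import all_classical all_reals all_analysis.
From mathcomp.real_closed Require Import complex.

Set Implicit Arguments.
Unset Strict Implicit.
Unset Printing Implicit Defensive.

Import Order.TTheory GRing.Theory Num.Theory.
Import numFieldNormedType.Exports.

Local Open Scope classical_set_scope.
Local Open Scope complex_scope.
Local Open Scope ring_scope.

(* A complex sequence (x_k) indexed by k = 1, 2, ... is a function x on nat
   whose value at 0 is never read. The sequence d is genuinely indexed from 0. *)

Section Definitions.
Variable R : realType.
Implicit Types (p gamma : R) (a g : nat -> R[i]) (d : nat -> nat).

Definition cabs (z : R[i]) : R := Normc.normc z.

Definition lpnorm p a : \bar R :=
  ((\sum_(1 <= n <oo) ((cabs (a n) `^ p)%R)%:E) `^ p^-1)%E.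

Definition in_lp p a : Prop := (lpnorm p a < +oo)%E.

(* Used for n >= 1 only, with d strictly increasing, so that n.-1 and the
   subtraction of naturals are the usual ones. *)
Definition blockmean p d g (n : nat) : R :=
  ((d n - d n.-1)%N%:R)^-1 * \sum_(d n.-1 <= k < d n) cabs (g k) `^ p.

Definition dratio d (j : nat) : R := (d j)%:R / (d j.-1)%:R.

(* The regular module R[i]^o carries the usual topology of the complex plane. *)
Definition Hpartial gamma g a (k : nat) : nat -> R[i]^o :=
  fun N => \sum_(1 <= n < N)
    ((k%:R / n%:R) `^ gamma)%:C * (g k * a n) / (n + k)%N%:R.

Definition Hop gamma g a : nat -> R[i] := fun k => limn (Hpartial gamma g a k).

Definition Hbounded p gamma g : Prop :=
  exists M : R, forall a, in_lp p a ->
    (forall k, (0 < k)%N -> cvgn (Hpartial gamma g a k)) /\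
    (lpnorm p (Hop gamma g a) <= M%:E * lpnorm p a)%E.

Definition CK p gamma d (K : nat) g a : \bar R :=
  ((\sum_(d K.-1 <= k <oo) ((cabs (Hop gamma g a k) `^ p)%R)%:E) `^ p^-1)%E.

Definition esup_from (K : nat) (F : nat -> R) : \bar R :=
  ereal_sup [set (F j)%:E | j in [set j | (K <= j)%N]].

Definition einf_from (K : nat) (F : nat -> R) : \bar R :=
  ereal_inf [set (F j)%:E | j in [set j | (K <= j)%N]].

End Definitions.

(* Main.v *)
Require Import Defs.
From mathcomp Require Import all_boot all_order all_algebra.
From mathcomp Require Import all_classical all_reals all_analysis.
From mathcomp.real_closed Require Import complex.
From mathcomp Require Import measurable_realfun lra zify ring.

(* Put S_k = sum_n (k/n)^gamma a_n / (n+k), so that |(H_g a)_k| <= |g_k| S_k(|a|),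
   with equality when a >= 0.

   Upper bound: for k, l in the same block the summands of S_k and S_l differ at
   most by the factor max (d_j/d_(j-1))^(1-gamma) (d_j/d_(j-1))^gamma, so on each
   block S_k is comparable to every mean of S_l.

   Boundedness: Jensen's inequality for the weights (k/n)^(gamma+1/p) / (n+k), whose
   total mass is bounded by a Hilbert-type estimate, gives both the pointwise bound
   S_k^p <= C ||a||^p / k and the Schur-type bound sum_k S_k^p <= C ||a||^p.

   Lower bound: with h(x) = x^(-|gamma|) / (1+x) and D = d_j, the sequence
   a_n = h(max(n/D, 3))^(p'-1) is nonincreasing, hence a_n >= h(max(n/k, 3))^(p'-1)
   for all k <= D. Thus a single sequence makes all S_k, k <= D,
   simultaneously large; the part n < 3k of S_k compensates for the contribution of
   the constant part of a to its norm, and the part n >= 3k is a Riemann sum of the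
   integral in the statement.

   The necessity in (1) follows from the same test sequence with g concentrated at
   the left end points of the blocks. For the necessity in (2), g is large on blocks
   whose ratio is so close to 1 that S_k^p <= C ||a||^p / k makes the sum converge. *)

Set Implicit Arguments.
Unset Strict Implicit.
Unset Printing Implicit Defensive.

Import Order.TTheory GRing.Theory Num.Theory.
Import numFieldNormedType.Exports.

Local Open Scope classical_set_scope.
Local Open Scope complex_scope.
Local Open Scope ring_scope.

(** * Inequalities for real powers *)

Section PowerInequalities.
Variable R : realType.
Implicit Types (p r s x y : R).

Lemma powR_addr x r s : 0 < x -> x `^ (r + s) = x `^ r * x `^ s.
Proof. by move=> x0; apply: powRD; apply/implyP => _; rewrite gt_eqF. Qed.

Lemma powR_subr1 x s : 0 < x -> x `^ (s - 1) = x `^ s / x.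
Proof. by move=> x0; rewrite powR_addr// powR_inv1// ltW. Qed.

Lemma powRV x s : 0 <= x -> x^-1 `^ s = x `^ (- s).
Proof. by move=> x0; rewrite -powR_inv1// -powRrM mulN1r. Qed.

Lemma powR_divr x y s : 0 <= x -> 0 <= y -> (x / y) `^ s = x `^ s * y `^ (- s).
Proof. by move=> x0 y0; rewrite powRM ?invr_ge0// powRV. Qed.

(** Young's inequality for the exponents [p] and [p / (p - 1)], applied to [x] and 1. The left side
    is the tangent of the convex function [x ^ p] at 1. *)
Lemma powR_ge_tangent p x : 1 < p -> 0 <= x -> p * x - (p - 1) <= x `^ p.
Proof.
move=> p1 x0; have p0 : 0 < p by lra.
have p10 : 0 < p - 1 by lra.
have q0 : 0 < p / (p - 1) by rewrite divr_gt0.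
have pq : p^-1 + (p / (p - 1))^-1 = 1.
  by rewrite invf_div; field; rewrite gt_eqF.
have := conjugate_powR x0 (@ler01 R) p0 q0 pq.
rewrite powR1 mul1r mulr1 invf_div -(ler_pM2l p0) mulrDr.
have -> : p * (x `^ p / p) = x `^ p by field; rewrite gt_eqF.
have -> : p * ((p - 1) / p) = p - 1 by field; rewrite gt_eqF.
lra.
Qed.

(** Young's inequality for the exponents [1 / s] and [1 / (1 - s)], applied to [x ^ s] and 1. *)
Lemma powR_le_chord s x : 0 < s < 1 -> 0 <= x -> x `^ s <= s * x + (1 - s).
Proof.
move=> /andP[s0 s1] x0.
have s10 : 0 < 1 - s by lra.
have iq : s^-1^-1 + (1 - s)^-1^-1 = 1 by rewrite !invrK; ring.
have := conjugate_powR (powR_ge0 x s) (@ler01 R) _ _ iq.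
rewrite !invr_gt0 => /(_ s0 s10).
rewrite powR1 mulr1 mul1r !invrK -powRrM divff ?gt_eqF// powRr1//.
by rewrite mulrC.
Qed.

(** The previous bound at [n / (n + 1)], in a form that telescopes. It replaces the comparison of a
    sum of powers with an integral. *)
Lemma powR_diff_ge s (n : nat) : 0 < s < 1 ->
  s * n.+1%:R `^ (s - 1) <= n.+1%:R `^ s - n%:R `^ s.
Proof.
move=> s01; set x : R := n.+1%:R.
have x0 : 0 < x by rewrite ltr0n.
have -> : (n%:R : R) = x * (n%:R / x) by field; rewrite gt_eqF.
have t0 : 0 <= n%:R / x by rewrite divr_ge0 ?ler0n// ltW.
rewrite powRM ?(ltW x0)// powR_subr1//.
have := ler_wpM2l (powR_ge0 x s) (powR_le_chord s01 t0).
have -> : n%:R / x = 1 - x^-1.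
  by rewrite (_ : n%:R = x - 1) /x ?mulrBl ?divff ?gt_eqF// ?mul1r// -natr1 addrK.
rewrite (_ : x `^ s * (s * _ + _) = x `^ s - s * (x `^ s / x)); first by rewrite !lerBrDr addrC.
by field; rewrite gt_eqF.
Qed.

(** The telescoping bound for negative exponents. It rests on [(1 - 1/x) ^ (- s) >= 1 + s / x],
    which follows from [exp t >= 1 + t] and [ln (1 + t) <= t]. *)
Lemma powRN_diff_ge s (n : nat) : 0 < s -> (0 < n)%N ->
  s * n.+1%:R `^ (- s - 1) <= n%:R `^ (- s) - n.+1%:R `^ (- s).
Proof.
move=> s0 n0; set x : R := n.+1%:R; set y : R := n%:R.
have x0 : 0 < x by rewrite ltr0n.
have y0 : 0 < y by rewrite ltr0n.
have xy : x = y + 1 by rewrite /x -natr1.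
have -> : y = x * (y / x) by field; rewrite gt_eqF.
have yx0 : 0 < y / x by rewrite divr_gt0.
rewrite powRM ?(ltW x0) ?(ltW yx0)// powR_subr1//.
have : 1 + s / x <= (y / x) `^ (- s).
  rewrite /powR gt_eqF ?divr_gt0//.
  apply: (le_trans (expR_ge1Dx _)); rewrite ler_expR mulNr -mulrN ler_pM2l//.
  rewrite (_ : y / x = 1 + - x^-1); last by rewrite xy; field; rewrite -xy gt_eqF.
  rewrite -[leLHS]opprK lerN2; apply: le_ln1Dx.
  by rewrite ltrN2 invf_lt1// xy; lra.
move=> /(ler_wpM2l (powR_ge0 x (- s))).
rewrite mulrDr mulr1.
by rewrite (_ : _ * (s / x) = s * (x `^ (- s) / x)); [rewrite lerBrDr addrC | ring].
Qed.

(** Bounding [n + k] below by [k] for [n <= k] and by [n] for [n > k] leaves pure powers of [n]; the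
    two ranges contribute [1 / (1 - s)] and [1 / s]. *)
Lemma sum_hilbert_le s (k N : nat) : 0 < s < 1 -> (0 < k)%N ->
  \sum_(1 <= n < N) (k%:R / n%:R) `^ s / (n + k)%:R <= (1 - s)^-1 + s^-1.
Proof.
move=> s01 k0; have /andP[s0 s1] := s01.
have s10 : 0 < 1 - s by lra.
set x : R := k%:R; have x0 : 0 < x by rewrite ltr0n.
have s10' : 1 - s != 0 by rewrite gt_eqF.
(* A primitive of the majorant of the summand: [x^(s-1) y^(-s)] for [y <= x]
   and [x^s y^(-s-1)] for [y >= x]. *)
pose F (n : nat) : R := if (n <= k)%N then x `^ (s - 1) * n%:R `^ (1 - s) / (1 - s)
  else (1 - s)^-1 + (1 - x `^ s * n%:R `^ (- s)) / s.
have xs1 : x `^ (s - 1) * x `^ (1 - s) = 1.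
  by rewrite -powR_addr// (_ : _ + _ = 0) ?powRr0//; ring.
have xs : x `^ s * x `^ (- s) = 1.
  by rewrite -powR_addr// subrr powRr0.
have sumF M : \sum_(1 <= n < M.+1) (x / n%:R) `^ s / (n + k)%:R <= F M.
  elim: M => [|M IH]; first by rewrite big_geq// /F leq0n powR0// mulr0 mul0r.
  rewrite big_nat_recr//=.
  have M0 : 0 < (M.+1%:R : R) by rewrite ltr0n.
  have -> : (x / M.+1%:R) `^ s = x `^ s * M.+1%:R `^ (- s).
    by rewrite powR_divr// ltW.
  apply: (le_trans (lerD IH (lexx _))); rewrite -lerBrDl /F.
  have [Mk|kM] := leqP M.+1 k.
    rewrite (ltnW Mk) -mulrBl -mulrBr.
    have s01' : 0 < 1 - s < 1 by apply/andP; split; lra.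
    have := powR_diff_ge M s01'; rewrite (_ : 1 - s - 1 = - s); last by ring.
    move=> H; apply: (@le_trans _ _ (x `^ s * M.+1%:R `^ (- s) / x)).
      rewrite ler_wpM2l ?mulr_ge0 ?powR_ge0// lef_pV2 ?posrE ?ltr0n ?addn_gt0//.
      by rewrite ler_nat leq_addl.
    rewrite powR_subr1// ler_pdivlMr//.
    have xsx : 0 <= x `^ s / x by rewrite divr_ge0 ?powR_ge0// ltW.
    have := ler_wpM2l xsx H.
    by congr (_ <= _); ring.
  (* The two formulas for [F] agree at [k], so the second one may be used at [M = k] as well. *)
  have -> : (if (M <= k)%N then x `^ (s - 1) * M%:R `^ (1 - s) / (1 - s)
      else (1 - s)^-1 + (1 - x `^ s * M%:R `^ (- s)) / s) =
      (1 - s)^-1 + (1 - x `^ s * M%:R `^ (- s)) / s.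
    case: ifP => // Mk; have -> : M = k by apply/eqP; rewrite eqn_leq Mk -ltnS.
    by rewrite xs xs1 subrr !mul0r addr0 mul1r.
  have M1 : (0 < M)%N by rewrite (leq_trans k0).
  have := powRN_diff_ge s0 M1; rewrite powR_subr1//.
  move=> H; apply: (@le_trans _ _ (x `^ s * (M.+1%:R `^ (- s) / M.+1%:R))).
    rewrite -mulrA ler_wpM2l ?powR_ge0// ler_wpM2l ?powR_ge0//.
    by rewrite lef_pV2 ?posrE ?ltr0n ?addn_gt0// ler_nat leq_addr.
  have -> : (1 - s)^-1 + (1 - x `^ s * M.+1%:R `^ (- s)) / s -
    ((1 - s)^-1 + (1 - x `^ s * M%:R `^ (- s)) / s) =
     x `^ s * (M%:R `^ (- s) - M.+1%:R `^ (- s)) / s by ring.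
  rewrite -mulrA ler_wpM2l ?powR_ge0// ler_pdivlMr// mulrC.
  exact: H.
case: N => [|N]; first by rewrite big_geq// addr_ge0 ?invr_ge0 ?ltW.
apply: (le_trans (sumF N)); rewrite /F; case: ifP => [Nk|_].
  apply: (@le_trans _ _ (1 - s)^-1); last by rewrite lerDl invr_ge0 ltW.
  rewrite -[leRHS]mul1r ler_pM2r ?invr_gt0// -[leRHS]xs1.
  apply: ler_wpM2l; first exact: powR_ge0.
  by apply: ge0_ler_powR; rewrite ?nnegrE ?ler0n ?(ltW s10)// ler_nat.
rewrite lerD2l -[leRHS]mul1r ler_pM2r ?invr_gt0// gerBl.
by rewrite mulr_ge0 ?powR_ge0.
Qed.

(** Jensen's inequality with weights [w] that need not sum to 1. The tangent of the power is taken
    at the weighted mean [u = S / W], where the linear terms cancel after summation. *)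
Lemma power_mean_le p (w x : nat -> R) (m N : nat) : 1 < p ->
  (forall n, 0 <= w n) -> (forall n, 0 <= x n) ->
  (\sum_(m <= n < N) w n * x n) `^ p <=
  (\sum_(m <= n < N) w n) `^ (p - 1) * \sum_(m <= n < N) w n * x n `^ p.
Proof.
move=> p1 w0 x0; have p0 : 0 < p by lra.
set W := \sum_(_ <= _ < _) w _; set S := \sum_(_ <= _ < _) _ * x _.
have S0 : 0 <= S by apply: sumr_ge0 => i _; rewrite mulr_ge0.
have rhs0 : 0 <= W `^ (p - 1) * \sum_(m <= n < N) w n * x n `^ p.
  by rewrite mulr_ge0 ?powR_ge0// sumr_ge0// => i _; rewrite mulr_ge0// powR_ge0.
have [->|Sn0] := eqVneq S 0; first by rewrite powR0 ?gt_eqF.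
have Sp : 0 < S by rewrite lt_neqAle eq_sym Sn0.
have Wp : 0 < W.
  rewrite lt_neqAle sumr_ge0// andbT eq_sym; apply: contra Sn0 => /eqP W0.
  rewrite /S big_nat_cond big1// => i /andP[/andP[mi iN] _].
  suff -> : w i = 0 by rewrite mul0r.
  apply/eqP; rewrite eq_le w0 andbT -W0 /W.
  rewrite (bigD1_seq i) ?mem_index_iota ?mi ?iota_uniq//=.
  by rewrite lerDl sumr_ge0.
pose u := S / W; have u0 : 0 < u by rewrite divr_gt0.
have key n : w n * (u `^ p + p * u `^ (p - 1) * (x n - u)) <= w n * x n `^ p.
  apply: ler_wpM2l => //.
  have xu : 0 <= x n / u by rewrite divr_ge0// ltW.
  have := ler_wpM2l (powR_ge0 u p) (powR_ge_tangent p1 xu).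
  rewrite -powRM ?(ltW u0)// (_ : u * (x n / u) = x n); last by field; rewrite gt_eqF.
  apply: le_trans; rewrite powR_subr1// le_eqVlt; apply/orP; left; apply/eqP.
  by field; rewrite gt_eqF.
have : W * u `^ p <= \sum_(m <= n < N) w n * x n `^ p.
  apply: le_trans (ler_sum _ (fun n _ => key n)).
  under eq_bigr => n _ do rewrite mulrDr mulrCA mulrBr.
  rewrite big_split/= -mulr_suml -mulr_sumr.
  rewrite sumrB -mulr_suml -/S -/W (_ : W * u = S) ?subrr ?mulr0 ?addr0//.
  by rewrite /u; field; rewrite gt_eqF.
move=> /(ler_wpM2l (powR_ge0 W (p - 1))); apply: le_trans.
rewrite mulrA [_ `^ _ * W]mulrC mulr_powRB1 ?(ltW Wp)// -powRM ?(ltW Wp) ?(ltW u0)//.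
by rewrite /u (_ : W * (S / W) = S)//; field; rewrite gt_eqF.
Qed.

End PowerInequalities.

(** * The kernel and its Schur bounds *)

(** The limit is taken positive because the power is treated as [exp (s * ln x)]. *)
Lemma cvg_powR (R : realType) (u : nat -> R) (l s : R) : 0 < l ->
  u n @[n --> \oo] --> l -> u n `^ s @[n --> \oo] --> l `^ s.
Proof.
move=> l0 ul; rewrite [l `^ s]/powR gt_eqF//.
apply: (@cvg_trans _ (expR (s * ln (u n)) @[n --> \oo])).
  apply: near_eq_cvg; near=> n; rewrite /powR gt_eqF//.
  by near: n; exact: (cvgr_gt l).
apply: continuous_cvg; first exact: continuous_expR.
apply: cvgMr; apply: continuous_cvg => //; exact: continuous_ln.
Unshelve. all: by end_near. Qed.

Section Kernel.
Variable R : realType.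
Implicit Types (p gamma s : R) (b : nat -> R).

Definition kern gamma (k n : nat) : R := (k%:R / n%:R) `^ gamma / (n + k)%:R.

(** This is the sum S_k of the overview, with real coefficients. *)
Definition hsum gamma b (k : nat) : R :=
  limn (fun N => \sum_(1 <= n < N) kern gamma k n * b n).

Lemma kern_ge0 gamma k n : 0 <= kern gamma k n.
Proof. by rewrite mulr_ge0 ?powR_ge0// invr_ge0. Qed.

Lemma kernM gamma s k n : (0 < k)%N -> (0 < n)%N ->
  kern gamma k n * (k%:R / n%:R) `^ s = kern (gamma + s) k n.
Proof.
move=> k0 n0; rewrite /kern powR_addr; first by rewrite mulrAC.
by rewrite divr_gt0 ?ltr0n.
Qed.

(** Transposition turns column sums of the kernel into row sums, which [sum_hilbert_le] controls. *)
Lemma kernC gamma k n : (0 < k)%N -> (0 < n)%N ->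
  kern gamma k n = kern (- gamma) n k.
Proof.
move=> k0 n0; rewrite /kern addnC -powRV ?divr_ge0//.
by rewrite invf_div.
Qed.

(** The chord bound gives [(n/k) ^ s <= n/k + 1 = (n + k) / k], which cancels the denominator. *)
Lemma kernN_le s k n : 0 < s < 1 -> (0 < k)%N -> (0 < n)%N ->
  kern (- s) k n <= k%:R^-1.
Proof.
move=> /andP[s0 s1] k0 n0.
have K0 : 0 < (k%:R : R) by rewrite ltr0n.
rewrite /kern -powRV ?divr_ge0// invf_div ler_pdivrMr ?ltr0n ?addn_gt0 ?k0 ?orbT//.
have nk : 0 <= (n%:R / k%:R : R) by rewrite divr_ge0.
apply: (le_trans (powR_le_chord _ nk)); first by rewrite s0.
have -> : k%:R^-1 * (n + k)%:R = n%:R / k%:R + 1 :> R.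
  by rewrite natrD; field; rewrite gt_eqF.
by apply: lerD; [rewrite ler_piMl// ltW | rewrite gerBl ltW].
Qed.

Definition hilbert_cst s : R := (1 - s)^-1 + s^-1.

Lemma hilbert_cst_ge0 s : 0 < s < 1 -> 0 <= hilbert_cst s.
Proof. by move=> /andP[s0 s1]; rewrite addr_ge0// invr_ge0; lra. Qed.

(** Jensen's inequality for the weights with exponent [gamma + 1/p], which lies in [(0, 1)] by the
    hypothesis on [gamma], and the values [(n/k) ^ (1/p) * b n]. Raising these to the power [p]
    yields the factor [n/k] that lowers the exponent by 1. *)
Lemma sum_kern_powR_le p gamma b (k N : nat) : 1 < p -> - p^-1 < gamma < 1 - p^-1 ->
  (0 < k)%N -> (forall n, 0 <= b n) ->
  (\sum_(1 <= n < N) kern gamma k n * b n) `^ p <=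
  hilbert_cst (gamma + p^-1) `^ (p - 1) *
    \sum_(1 <= n < N) kern (gamma + p^-1 - 1) k n * b n `^ p.
Proof.
move=> p1 /andP[g1 g2] k0 b0; have p0 : 0 < p by lra.
have K0 : 0 < (k%:R : R) by rewrite ltr0n.
have x0 n : 0 <= (n%:R / k%:R) `^ p^-1 * b n by rewrite mulr_ge0 ?powR_ge0.
have -> : \sum_(1 <= n < N) kern gamma k n * b n =
  \sum_(1 <= n < N) kern (gamma + p^-1) k n * ((n%:R / k%:R) `^ p^-1 * b n).
  apply: eq_big_nat => n /andP[n0 _].
  rewrite -kernM// -mulrA; congr (_ * _); rewrite mulrA -powRM ?divr_ge0//.
  rewrite (_ : k%:R / n%:R * (n%:R / k%:R) = 1) ?powR1 ?mul1r//.
  by field; rewrite !pnatr_eq0 -!lt0n n0 k0.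
apply: (le_trans (power_mean_le _ _ p1 (fun n => kern_ge0 _ _ n) x0)).
apply: ler_pM; rewrite ?powR_ge0//.
- by rewrite sumr_ge0// => n _; rewrite mulr_ge0 ?powR_ge0 ?kern_ge0.
- apply: ge0_ler_powR; rewrite ?nnegrE; first lra.
  + by rewrite sumr_ge0// => n _; exact: kern_ge0.
  + by apply: hilbert_cst_ge0; apply/andP; split; lra.
  + by apply: sum_hilbert_le => //; apply/andP; split; lra.
- rewrite le_eqVlt; apply/orP; left; apply/eqP.
  apply: eq_big_nat => n /andP[n0 _].
  have nk : 0 <= (n%:R / k%:R : R) by rewrite divr_ge0.
  rewrite powRM ?powR_ge0// -powRrM mulVf ?gt_eqF// powRr1// mulrA; congr (_ * _).
  rewrite -[in RHS]kernM//; congr (_ * _).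
  by rewrite powRN powRr1 ?divr_ge0// invf_div.
Qed.

Section HilbertSums.
Variables (p gamma : R) (b : nat -> R) (B : R).
Hypotheses (p1 : 1 < p) (gp : - p^-1 < gamma < 1 - p^-1).
Hypotheses (b0 : forall n, 0 <= b n) (bB : forall N, \sum_(1 <= n < N) b n `^ p <= B).

Let p0 : 0 < p. Proof. exact: lt_trans ltr01 p1. Qed.
Let C1 := hilbert_cst (gamma + p^-1) `^ (p - 1).
Let C1_ge0 : 0 <= C1. Proof. exact: powR_ge0. Qed.
Let s01 : 0 < 1 - gamma - p^-1 < 1.
Proof. by case/andP: gp => ? ?; apply/andP; split; lra. Qed.
Let B0 : 0 <= B. Proof. by have := bB 0; rewrite big_geq. Qed.

Let psum k N := \sum_(1 <= n < N) kern gamma k n * b n.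

Let psum_ge0 k N : 0 <= psum k N.
Proof. by rewrite sumr_ge0// => n _; rewrite mulr_ge0// kern_ge0. Qed.

Let psum_nd k : nondecreasing_seq (psum k).
Proof.
apply/nondecreasing_seqP => n; case: n => [|n].
  by rewrite /psum !big_geq.
by rewrite /psum [leRHS]big_nat_recr//= lerDl mulr_ge0// kern_ge0.
Qed.

Let psum_powR_le k N : (0 < k)%N -> psum k N `^ p <= C1 / k%:R * B.
Proof.
move=> k0; apply: le_trans (sum_kern_powR_le N p1 gp k0 b0) _.
rewrite -mulrA ler_wpM2l//.
apply: (@le_trans _ _ (k%:R^-1 * \sum_(1 <= n < N) b n `^ p)).
  rewrite mulr_sumr; apply: ler_sum_nat => n /andP[n0 _].
  rewrite ler_wpM2r ?powR_ge0//.
  have := kernN_le s01 k0 n0.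
  by rewrite (_ : - (1 - gamma - p^-1) = gamma + p^-1 - 1)//; ring.
by rewrite ler_wpM2l// invr_ge0.
Qed.

Let psum_le k N : (0 < k)%N -> psum k N <= (C1 / k%:R * B) `^ p^-1.
Proof.
move=> k0.
have := psum_powR_le N k0 => /(ge0_ler_powR (r := p^-1)).
rewrite -powRrM divff ?gt_eqF// powRr1//; apply; rewrite ?nnegrE ?powR_ge0//.
  by rewrite invr_ge0 ltW.
by rewrite mulr_ge0// divr_ge0.
Qed.

Lemma is_cvg_hsum k : (0 < k)%N ->
  cvgn (fun N => \sum_(1 <= n < N) kern gamma k n * b n).
Proof.
move=> k0; apply: nondecreasing_is_cvgn; first exact: psum_nd.
by exists ((C1 / k%:R * B) `^ p^-1) => _ [N _ <-]; exact: psum_le.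
Qed.

Lemma hsum_ge k N : (0 < k)%N ->
  \sum_(1 <= n < N) kern gamma k n * b n <= hsum gamma b k.
Proof.
by move=> k0; apply: (nondecreasing_cvgn_le (psum_nd k)); exact: is_cvg_hsum.
Qed.

Lemma hsum_ge0 k : (0 < k)%N -> 0 <= hsum gamma b k.
Proof. by move=> k0; apply: le_trans (hsum_ge 0 k0); rewrite big_geq. Qed.

(** After Jensen's inequality each remaining kernel entry is at most [1/k], by [kernN_le] with
    [s = 1 - gamma - 1/p]. This pointwise decay is what makes large values of [g] on thin blocks
    harmless. *)
Lemma hsum_powR_le k : (0 < k)%N -> hsum gamma b k `^ p <= C1 / k%:R * B.
Proof.
move=> k0.
have h : hsum gamma b k <= (C1 / k%:R * B) `^ p^-1.
  by apply: limr_le; [exact: is_cvg_hsum | apply: nearW => N; exact: psum_le].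
have := ge0_ler_powR (ltW p0) _ _ h; rewrite !nnegrE => /(_ (hsum_ge0 k0) (powR_ge0 _ _)).
by rewrite -powRrM mulVf ?gt_eqF// powRr1// mulr_ge0// divr_ge0.
Qed.

Let cvg_psum_powR k : (0 < k)%N -> (fun N => psum k N `^ p) @ \oo --> hsum gamma b k `^ p.
Proof.
(* If the limit is 0, all partial sums vanish, so continuity of the power is needed only at positive
   limits. *)
move=> k0; have := hsum_ge0 k0; rewrite le_eqVlt => /predU1P[h0|h0].
  rewrite -h0 (_ : (fun N => _) = fun=> 0 `^ p); first exact: cvg_cst.
  apply/funext => N; congr (_ `^ _); apply/eqP; rewrite eq_le psum_ge0 andbT.
  by rewrite h0 hsum_ge.
have cu : psum k @ \oo --> hsum gamma b k by exact: is_cvg_hsum.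
exact: cvg_powR.
Qed.

(** Schur's test. Jensen's inequality is summed over [k] while the sum over [n] is still finite, so
    that the sums can be exchanged; the transposed column sums are Hilbert sums with exponent
    [1 - gamma - 1/p]. The limit in [n] comes last. *)
Lemma sum_hsum_powR_le M : \sum_(1 <= k < M) hsum gamma b k `^ p <=
  C1 * hilbert_cst (1 - gamma - p^-1) * B.
Proof.
have cv : (fun N => \sum_(1 <= k < M) psum k N `^ p) @ \oo -->
    \sum_(1 <= k < M) hsum gamma b k `^ p.
  rewrite big_nat_cond; under eq_fun do rewrite big_nat_cond.
  apply: (cvg_big (op := +%R)) => [|k /andP[/andP[k0 _] _]]; first exact: add_continuous.
  exact: cvg_psum_powR.
apply: cvgr_to_le (cv) _; apply: nearW => N.
apply: (@le_trans _ _ (\sum_(1 <= k < M) C1 *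
    \sum_(1 <= n < N) kern (gamma + p^-1 - 1) k n * b n `^ p)).
  by apply: ler_sum_nat => k /andP[k0 _]; exact: sum_kern_powR_le.
rewrite -mulr_sumr -mulrA ler_wpM2l// exchange_big/=.
apply: (@le_trans _ _ (\sum_(1 <= n < N) hilbert_cst (1 - gamma - p^-1) * b n `^ p)).
  apply: ler_sum_nat => n /andP[n0 _].
  rewrite -mulr_suml ler_wpM2r ?powR_ge0//.
  apply: le_trans (sum_hilbert_le M s01 n0).
  apply: ler_sum_nat => k /andP[k0 _].
  by rewrite kernC// (_ : - (gamma + p^-1 - 1) = 1 - gamma - p^-1)//; ring.
by rewrite -mulr_sumr ler_wpM2l ?hilbert_cst_ge0.
Qed.

End HilbertSums.
End Kernel.

(** * Reduction of the complex operator to nonnegative sums *)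

Section ComplexOperator.
Variable R : realType.
Local Notation Re := (@complex.Re R).
Local Notation Im := (@complex.Im R).
Implicit Types (p gamma : R) (a g : nat -> R[i]) (z w : R[i]).

Lemma cabs_ge0 z : 0 <= cabs z.
Proof. by case: z => x y; rewrite sqrtr_ge0. Qed.

Lemma cabsM z w : cabs (z * w) = cabs z * cabs w.
Proof. exact: Normc.normcM. Qed.

Lemma cabs_real (x : R) : cabs x%:C = `|x|.
Proof. by rewrite /cabs /= expr0n /= addr0 sqrtr_sqr. Qed.

Lemma sqr_cabs z : cabs z ^+ 2 = Re z ^+ 2 + Im z ^+ 2.
Proof. by case: z => x y; rewrite /cabs /= sqr_sqrtr// addr_ge0 ?sqr_ge0. Qed.

Lemma cabsE z : `|z| = (cabs z)%:C.
Proof. by case: z. Qed.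

Lemma cabs_le_add z : cabs z <= `|Re z| + `|Im z|.
Proof.
rewrite -(ler_pXn2r (n := 2)) ?nnegrE ?cabs_ge0 ?addr_ge0// sqr_cabs sqrrD.
by rewrite !real_normK ?num_real// addrAC lerDl mulrn_wge0// mulr_ge0.
Qed.

Lemma normRe_le_cabs z : `|Re z| <= cabs z.
Proof.
rewrite -(ler_pXn2r (n := 2)) ?nnegrE ?cabs_ge0// sqr_cabs real_normK ?num_real//.
by rewrite lerDl sqr_ge0.
Qed.

Lemma normIm_le_cabs z : `|Im z| <= cabs z.
Proof.
rewrite -(ler_pXn2r (n := 2)) ?nnegrE ?cabs_ge0// sqr_cabs real_normK ?num_real//.
by rewrite lerDr sqr_ge0.
Qed.

Lemma cvg_complex (u : nat -> R[i]^o) (x y : R) :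
  Re (u n) @[n --> \oo] --> x -> Im (u n) @[n --> \oo] --> y ->
  u n @[n --> \oo] --> (x +i* y : R[i]^o).
Proof.
move=> /cvgrPdist_lt ux /cvgrPdist_lt uy; apply/cvgrPdist_lt => e e0.
(* In the order of [R[i]] a positive [e] is real. *)
have [eI eR] : Im e = 0 /\ 0 < Re e.
  by move: e0; rewrite ltcE /= => /andP[/eqP <- ->].
have e2 : 0 < Re e / 2 by rewrite divr_gt0.
near=> n.
have -> : e = (Re e)%:C by move: eI; case: (e) => ? ? /= ->.
rewrite [X in X < _](_ : _ = (cabs (x +i* y - u n))%:C); last exact: cabsE.
rewrite ltcR; apply: le_lt_trans (cabs_le_add _) _.
rewrite [ltRHS]splitr; apply: ltrD.
  suff : `|x - Re (u n)| < Re e / 2 by case: (u n).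
  by near: n; exact: ux.
suff : `|y - Im (u n)| < Re e / 2 by case: (u n).
by near: n; exact: uy.
Unshelve. all: by end_near. Qed.

Lemma HpartialE gamma g a k N : Hpartial gamma g a k N =
  g k * ((\sum_(1 <= n < N) kern gamma k n * Re (a n)) +i*
         (\sum_(1 <= n < N) kern gamma k n * Im (a n))).
Proof.
rewrite /Hpartial.
have -> : (\sum_(1 <= n < N) kern gamma k n * Re (a n)) +i*
    (\sum_(1 <= n < N) kern gamma k n * Im (a n)) =
    \sum_(1 <= n < N) (kern gamma k n)%:C * a n :> R[i].
  elim: N => [|N IH]; first by rewrite !big_geq.
  case: N IH => [_|N IH]; first by rewrite !big_geq.
  rewrite !(@big_nat_recr _ _ _ N.+1)//= -IH.
  by case: (a N.+1) => s t; simpc.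
rewrite mulr_sumr; apply: eq_bigr => n _.
rewrite /kern rmorphM/= fmorphV rmorph_nat mulrCA -!mulrA; congr (_ * (_ * _)).
by rewrite mulrC.
Qed.

Section Convergence.
Variables (p gamma : R) (g a : nat -> R[i]) (B : R) (k : nat).
Hypotheses (p1 : 1 < p) (gp : - p^-1 < gamma < 1 - p^-1) (k0 : (0 < k)%N).
Hypothesis aB : forall N, \sum_(1 <= n < N) cabs (a n) `^ p <= B.

Let cabs_powB N : \sum_(1 <= n < N) (2 * cabs (a n)) `^ p <= 2 `^ p * B.
Proof.
under eq_bigr do rewrite powRM ?cabs_ge0//.
by rewrite -mulr_sumr ler_wpM2l ?powR_ge0.
Qed.

(** A signed sequence [f] dominated by [|a|] is the difference of the nonnegative sequences
    [|a| + f] and [|a|], and [|a| + f <= 2 |a|] is still p-summable. *)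
Let is_cvg_part (f : nat -> R) : (forall n, `|f n| <= cabs (a n)) ->
  cvgn (fun N => \sum_(1 <= n < N) kern gamma k n * f n).
Proof.
move=> fa.
have h0 n : 0 <= cabs (a n) + f n.
  by have := fa n; rewrite ler_norml => /andP[+ _]; rewrite -lerBlDr sub0r lerNl.
have hB N : \sum_(1 <= n < N) (cabs (a n) + f n) `^ p <= 2 `^ p * B.
  apply: le_trans (cabs_powB N); apply: ler_sum => n _.
  apply: ge0_ler_powR; rewrite ?nnegrE ?mulr_ge0 ?cabs_ge0//.
    by apply: ltW; exact: lt_trans ltr01 p1.
  by rewrite mulr2n mulrDl !mul1r lerD2l (le_trans (ler_norm _)).
have c1 := is_cvg_hsum p1 gp h0 hB k0.
have c2 := is_cvg_hsum p1 gp (fun n => cabs_ge0 (a n)) aB k0.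
suff -> : (fun N => \sum_(1 <= n < N) kern gamma k n * f n) =
  (fun N => \sum_(1 <= n < N) kern gamma k n * (cabs (a n) + f n)) \-
  (fun N => \sum_(1 <= n < N) kern gamma k n * cabs (a n)) by exact: is_cvgB.
apply/funext => N /=; rewrite -sumrB; apply: eq_bigr => n _.
by rewrite -mulrBr addrAC subrr add0r.
Qed.

Let X : R := limn (fun N => \sum_(1 <= n < N) kern gamma k n * Re (a n)).
Let Y : R := limn (fun N => \sum_(1 <= n < N) kern gamma k n * Im (a n)).

Let cvgX : (fun N => \sum_(1 <= n < N) kern gamma k n * Re (a n)) @ \oo --> X.
Proof. by apply: is_cvg_part => n; exact: normRe_le_cabs. Qed.

Let cvgY : (fun N => \sum_(1 <= n < N) kern gamma k n * Im (a n)) @ \oo --> Y.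
Proof. by apply: is_cvg_part => n; exact: normIm_le_cabs. Qed.

Let cvg_Hp : Hpartial gamma g a k @ \oo --> (g k * (X +i* Y) : R[i]^o).
Proof.
rewrite (_ : Hpartial _ _ _ _ = fun N => g k * ((\sum_(1 <= n < N) kern gamma k n * Re (a n)) +i*
         (\sum_(1 <= n < N) kern gamma k n * Im (a n)))); last first.
  by apply/funext => N; exact: HpartialE.
case: (g k) => s t.
apply: cvg_complex; apply: cvg_trans.
- apply: (@cvgB _ R^o); apply: cvgMr; [exact: cvgX | exact: cvgY].
- by [].
- apply: (@cvgD _ R^o); apply: cvgMr; [exact: cvgY | exact: cvgX].
- by [].
Qed.

Lemma is_cvg_Hpartial : cvgn (Hpartial gamma g a k).
Proof. by apply/cvg_ex; exists (g k * (X +i* Y)). Qed.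

Let HopE : Hop gamma g a k = g k * (X +i* Y).
Proof. by apply: cvg_lim cvg_Hp; exact: norm_hausdorff. Qed.

Lemma cabs_Hop_le : cabs (Hop gamma g a k) <= cabs (g k) * hsum gamma (fun n => cabs (a n)) k.
Proof.
rewrite HopE cabsM ler_wpM2l ?cabs_ge0//.
have h0 : 0 <= hsum gamma (fun n => cabs (a n)) k.
  by apply: (hsum_ge0 p1 gp _ aB k0) => n; exact: cabs_ge0.
(* The squared modulus is a polynomial in the real and imaginary parts, so a bound on the partial
   sums passes to the limit. *)
rewrite -(ler_pXn2r (n := 2)) ?nnegrE ?cabs_ge0// sqr_cabs/=.
apply: (cvgr_to_le (F := \oo) (f := fun N =>
   (\sum_(1 <= n < N) kern gamma k n * Re (a n)) ^+ 2 +
   (\sum_(1 <= n < N) kern gamma k n * Im (a n)) ^+ 2)).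
  by rewrite !expr2; apply: cvgD; apply: cvgM.
apply: nearW => N.
have -> : (\sum_(1 <= n < N) kern gamma k n * Re (a n)) ^+ 2 +
   (\sum_(1 <= n < N) kern gamma k n * Im (a n)) ^+ 2 =
   cabs ((\sum_(1 <= n < N) kern gamma k n * Re (a n)) +i*
         (\sum_(1 <= n < N) kern gamma k n * Im (a n))) ^+ 2 by rewrite sqr_cabs.
rewrite ler_pXn2r ?nnegrE ?cabs_ge0//.
apply: le_trans (hsum_ge p1 gp _ aB N k0); last by move=> n; exact: cabs_ge0.
(* Triangle inequality by induction. The sums start at 1, so both [N = 0] and [N = 1] give empty
   sums. *)
elim: N => [|N IH]; first by rewrite !big_geq// /cabs /= expr0n/= addr0 sqrtr0.
case: N IH => [_|N IH]; first by rewrite !big_geq// /cabs /= expr0n/= addr0 sqrtr0.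
rewrite !(@big_nat_recr _ _ _ N.+1)//.
apply: le_trans (lerD IH (lexx _)).
set x := \sum_(1 <= n < N.+1) kern gamma k n * Re (a n).
set y := \sum_(1 <= n < N.+1) kern gamma k n * Im (a n).
have -> : (x + kern gamma k N.+1 * Re (a N.+1)) +i* (y + kern gamma k N.+1 * Im (a N.+1))
  = (x +i* y) + (kern gamma k N.+1)%:C * a N.+1.
  by case: (a N.+1) => s t; simpc.
have := ler_normD (x +i* y) ((kern gamma k N.+1)%:C * a N.+1).
by rewrite !cabsE -rmorphD/= lecR cabsM cabs_real ger0_norm// kern_ge0.
Qed.

Lemma cabs_Hop_ge0E : (forall n, (0 < n)%N -> 0 <= a n) ->
  cabs (Hop gamma g a k) = cabs (g k) * hsum gamma (fun n => cabs (a n)) k.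
Proof.
move=> a0; rewrite HopE cabsM; congr (_ * _).
have aE n : (0 < n)%N -> Im (a n) = 0 /\ Re (a n) = cabs (a n).
  move=> /a0; rewrite lecE => /andP[/eqP ai ar]; split=> //.
  rewrite /cabs; move: ai ar; case: (a n) => x y /= -> x0.
  by rewrite expr0n/= addr0 sqrtr_sqr ger0_norm.
have -> : Y = 0.
  rewrite /Y (_ : (fun N => _) = fun=> 0) ?lim_cst//.
  apply/funext => N; rewrite big_nat_cond big1// => n /andP[/andP[n0 _] _].
  by rewrite (aE n n0).1 mulr0.
have -> : X = hsum gamma (fun n => cabs (a n)) k.
  congr (limn _); apply/funext => N.
  by apply: eq_big_nat => n /andP[n0 _] /=; rewrite (aE n n0).2.
rewrite -[_ +i* 0]/(_%:C) cabs_real ger0_norm//.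
by apply: (hsum_ge0 p1 gp _ aB k0) => n; exact: cabs_ge0.
Qed.

End Convergence.
End ComplexOperator.

(** * The upper bound *)

Section TailNorm.
Variable R : realType.
Implicit Types (p : R) (u v : nat -> R).

(** Common form of [lpnorm] (start 1) and [CK] (start [d K.-1]), applied to sequences of moduli. *)
Definition tailnorm p (m : nat) u : \bar R :=
  ((\sum_(m <= k <oo) ((u k `^ p)%R)%:E) `^ p^-1)%E.

Lemma ler_powR2r p (x y : R) : 0 < p -> 0 <= x -> x <= y -> x `^ p <= y `^ p.
Proof.
move=> p0 x0 xy; apply: ge0_ler_powR; rewrite ?nnegrE// ?(ltW p0)//.
exact: le_trans xy.
Qed.

Lemma powRK p (x : R) : 0 < p -> 0 <= x -> (x `^ p) `^ p^-1 = x.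
Proof. by move=> p0 x0; rewrite -powRrM divff ?gt_eqF// powRr1. Qed.

Lemma powRVK p (x : R) : 0 < p -> 0 <= x -> (x `^ p^-1) `^ p = x.
Proof. by move=> p0 x0; rewrite -powRrM mulVf ?gt_eqF// powRr1. Qed.

Lemma powRNVK p (x : R) : 0 < p -> 0 <= x -> (x `^ (- p^-1)) `^ p = x^-1.
Proof. by move=> p0 x0; rewrite -powRrM mulNr mulVf ?gt_eqF// powR_inv1. Qed.

Lemma lee_poweR (s : R) (x y : \bar R) : 0 < s -> (0 <= x)%E -> (x <= y)%E ->
  (x `^ s <= y `^ s)%E.
Proof.
move=> s0 x0 xy; apply: gt0_ler_poweR => //; first exact: ltW.
  by rewrite in_itv/= x0 leey.
by rewrite in_itv/= leey andbT (le_trans x0).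
Qed.

Let sum_ge0 p m u : (0 <= \sum_(m <= k <oo) ((u k `^ p)%R)%:E)%E.
Proof. by apply: nneseries_ge0 => n _ _; rewrite lee_fin powR_ge0. Qed.

Lemma powR_series_le p m u (B : \bar R) :
  (forall N, ((\sum_(m <= k < N) u k `^ p)%:E <= B)%E) ->
  (\sum_(m <= k <oo) ((u k `^ p)%R)%:E <= B)%E.
Proof.
move=> uB; apply: lime_le.
  by apply: is_cvg_nneseries => n _ _; rewrite lee_fin powR_ge0.
by apply: nearW => N; rewrite sumEFin.
Qed.

Lemma powR_series_ge p m u N :
  ((\sum_(m <= k < N) u k `^ p)%:E <= \sum_(m <= k <oo) ((u k `^ p)%R)%:E)%E.
Proof.
rewrite -sumEFin; apply: nneseries_lim_ge => n _ _.
by rewrite lee_fin powR_ge0.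
Qed.

Lemma tailnorm_le p m u (B : R) : 0 < p ->
  (forall N, \sum_(m <= k < N) u k `^ p <= B) ->
  (tailnorm p m u <= (B `^ p^-1)%:E)%E.
Proof.
move=> p0 uB; rewrite -poweR_EFin; apply: lee_poweR; rewrite ?invr_gt0//.
by apply: powR_series_le => N; rewrite lee_fin.
Qed.

Lemma tailnorm_ge p m u N : 0 < p ->
  (((\sum_(m <= k < N) u k `^ p) `^ p^-1)%:E <= tailnorm p m u)%E.
Proof.
move=> p0; rewrite -poweR_EFin; apply: lee_poweR; rewrite ?invr_gt0//.
  by rewrite lee_fin sumr_ge0// => k _; exact: powR_ge0.
exact: powR_series_ge.
Qed.

Lemma tailnorm_powR_le p m u (B : R) N : 0 < p -> 0 <= B ->
  (tailnorm p m u <= B%:E)%E -> \sum_(m <= k < N) u k `^ p <= B `^ p.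
Proof.
move=> p0 B0 uB.
have s0 : 0 <= \sum_(m <= k < N) u k `^ p by rewrite sumr_ge0// => k _; exact: powR_ge0.
rewrite -[leLHS](powRVK p0)//; apply: ler_powR2r; rewrite ?powR_ge0//.
by rewrite -lee_fin; exact: le_trans (tailnorm_ge _ _ _ p0) uB.
Qed.

(** The blocks from the [K]-th on partition the tail, so inequalities between block sums add up. *)
Lemma tailnorm_le_block p (s : R) (d : nat -> nat) K u v :
  0 < p -> 0 <= s -> (forall n, (d n < d n.+1)%N) -> (0 < K)%N ->
  (forall j, (K <= j)%N -> \sum_(d j.-1 <= k < d j) u k `^ p <=
     s `^ p * \sum_(d j.-1 <= k < d j) v k `^ p) ->
  (tailnorm p (d K.-1) u <= s%:E * tailnorm p (d K.-1) v)%E.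
Proof.
case: K => // K p0 s0 hd _ /= uv.
have dle i : (d K <= d (K + i))%N.
  by elim: i => [|i IH]; rewrite ?addn0// addnS (leq_trans IH)// ltnW.
have blocks i : \sum_(d K <= k < d (K + i)%N) u k `^ p <=
    s `^ p * \sum_(d K <= k < d (K + i)%N) v k `^ p.
  elim: i => [|i IH]; first by rewrite addn0 !big_geq// mulr0.
  rewrite addnS !(big_cat_nat (dle i) (ltnW (hd (K + i))))/=.
  by rewrite mulrDr lerD// (uv (K + i).+1)// ltnS leq_addr.
have dge i : (i <= d (K + i))%N.
  by elim: i => // i IH; rewrite addnS (leq_ltn_trans IH).
have key : (\sum_(d K <= k <oo) ((u k `^ p)%R)%:E <=
    (s `^ p)%:E * \sum_(d K <= k <oo) ((v k `^ p)%R)%:E)%E.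
  apply: powR_series_le => N.
  (* Since [N <= d (K + N)], any partial sum is dominated by one that ends at a block boundary. *)
  apply: (@le_trans _ _ (\sum_(d K <= k < d (K + N)%N) u k `^ p)%:E).
    rewrite lee_fin; have [KN|NK] := leqP (d K) N; last first.
      by rewrite (big_geq (ltnW NK)) sumr_ge0// => k _; exact: powR_ge0.
    rewrite [leRHS](big_cat_nat KN (dge N))/= lerDl.
    by rewrite sumr_ge0// => k _; exact: powR_ge0.
  apply: le_trans (lee_pmul _ _ (lexx _) (powR_series_ge p _ v (d (K + N)%N))).
  - by rewrite -EFinM lee_fin.
  - by rewrite lee_fin powR_ge0.
  - by rewrite lee_fin sumr_ge0// => k _; exact: powR_ge0.
rewrite -[X in (X%:E * _)%E](powRK p0 s0) -poweR_EFin -poweRM ?lee_fin ?powR_ge0//.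
by apply: lee_poweR; rewrite ?invr_gt0.
Qed.

End TailNorm.

(** * Comparison of the sums S_k within a block *)

Section UpperBound.
Variable R : realType.
Implicit Types (p gamma : R).

(** The quotient of the two kernels is [(k/l) ^ gamma * (n + l) / (n + k)]. For [k <= l] the
    fraction is at most [l/k], which gives [(l/k) ^ (1 - gamma)]. For [k > l] it is at most 1; then
    [(k/l) ^ gamma] is bounded by [(v/u) ^ gamma] if [gamma >= 0] and by 1 otherwise. *)
Lemma kern_block_le gamma (u v k l n : nat) : gamma < 1 -> (0 < u)%N ->
  (u <= k < v)%N -> (u <= l < v)%N -> (0 < n)%N ->
  kern gamma k n <= Num.max ((v%:R / u%:R) `^ (1 - gamma)) ((v%:R / u%:R) `^ gamma) *
    kern gamma l n.
Proof.
move=> g1 u0 /andP[uk kv] /andP[ul lv] n0.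
have k0 : (0 < k)%N by apply: leq_trans uk.
have l0 : (0 < l)%N by apply: leq_trans ul.
have U0 : 0 < (u%:R : R) by rewrite ltr0n.
have K0 : 0 < (k%:R : R) by rewrite ltr0n.
have L0 : 0 < (l%:R : R) by rewrite ltr0n.
have N0 : 0 < (n%:R : R) by rewrite ltr0n.
have kl0 : 0 < (k%:R / l%:R : R) by rewrite divr_gt0.
have nk0 : 0 < ((n + k)%:R : R) by rewrite ltr0n addn_gt0 n0.
have nl0 : 0 < ((n + l)%:R : R) by rewrite ltr0n addn_gt0 n0.
have ratio (x y : nat) : (0 < x)%N -> (u <= x)%N -> (y < v)%N ->
    (y%:R / x%:R <= v%:R / u%:R :> R).
  move=> x0 ux yv; apply: ler_pM; rewrite ?invr_ge0 ?ler0n ?ler_nat ?(ltnW yv)//.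
  by rewrite lef_pV2 ?posrE ?ltr0n// ler_nat.
have kgE : kern gamma k n = (k%:R / l%:R) `^ gamma * ((n + l)%:R / (n + k)%:R) *
    kern gamma l n.
  rewrite /kern (_ : k%:R / n%:R = (k%:R / l%:R) * (l%:R / n%:R)); last first.
    by field; rewrite !gt_eqF.
  by rewrite powRM ?divr_ge0 ?ler0n//; field; rewrite !gt_eqF// -?natrD ?gt_eqF.
rewrite kgE ler_wpM2r ?kern_ge0// le_max.
have [kl|lk] := leqP k l.
  apply/orP; left; apply: (@le_trans _ _ ((l%:R / k%:R) `^ (1 - gamma))); last first.
    by apply: ler_powR2r; rewrite ?subr_gt0 ?divr_ge0// ratio.
  rewrite powR_addr ?divr_gt0// powRr1 ?divr_ge0// mulrC -[_ `^ (- _)]powRV ?divr_ge0//.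
  rewrite invf_div ler_wpM2r ?powR_ge0// ler_pdivrMr// mulrAC ler_pdivlMr//.
  rewrite -!natrM ler_nat mulnDl mulnDr leq_add2r mulnC.
  by rewrite leq_mul2r kl orbT.
have nlk : (n + l)%:R / (n + k)%:R <= 1 :> R.
  by rewrite ler_pdivrMr// mul1r ler_nat leq_add2l ltnW.
apply/orP; have [gp|gn] := leP 0 gamma; [right|left].
  apply: (@le_trans _ _ ((k%:R / l%:R) `^ gamma)); first by rewrite ler_piMr ?powR_ge0.
  move: gp; rewrite le_eqVlt => /predU1P[<-|gp]; first by rewrite !powRr0.
  by apply: ler_powR2r => //; exact: ratio.
apply: (@le_trans _ _ 1); last first.
  rewrite -[leLHS](powRr0 (v%:R / u%:R)); apply: ler_powR; last by lra.
  by rewrite ler_pdivlMr// mul1r ler_nat (leq_trans uk)// ltnW.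
apply: mulr_ile1; rewrite ?powR_ge0 ?divr_ge0//.
rewrite -[leRHS](powRr0 (k%:R / l%:R)); apply: ler_powR; last exact: ltW.
by rewrite ler_pdivlMr// mul1r ler_nat ltnW.
Qed.

Variables (p gamma : R) (d : nat -> nat).
Hypotheses (p1 : 1 < p) (gp : - p^-1 < gamma < 1 - p^-1).
Hypotheses (hd : forall n, (d n < d n.+1)%N) (hd0 : d 0%N = 1%N).

Lemma block_start_gt0 j : (0 < d j)%N.
Proof. by elim: j => [|j IH]; rewrite ?hd0// (leq_ltn_trans _ (hd j)). Qed.

Definition growth j : R := Num.max (dratio R d j `^ (1 - gamma)) (dratio R d j `^ gamma).

Let p0 : 0 < p. Proof. exact: lt_trans ltr01 p1. Qed.

Lemma hsum_block_le (b : nat -> R) (B : R) j k l :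
  (forall n, 0 <= b n) -> (forall N, \sum_(1 <= n < N) b n `^ p <= B) ->
  (d j.-1 <= k < d j)%N -> (d j.-1 <= l < d j)%N ->
  hsum gamma b k <= growth j * hsum gamma b l.
Proof.
move=> b0 bB kj lj.
have g1 : gamma < 1 by case/andP: gp => _ /lt_le_trans; apply; rewrite gerBl invr_ge0 ltW.
have pos m : (d j.-1 <= m < d j)%N -> (0 < m)%N.
  by case/andP => + _; apply: leq_trans; exact: block_start_gt0.
have G0 : 0 <= growth j by rewrite le_max powR_ge0.
apply: limr_le; first exact: (is_cvg_hsum p1 gp b0 bB (pos _ kj)).
apply: nearW => N.
apply: (@le_trans _ _ (growth j * \sum_(1 <= n < N) kern gamma l n * b n)).
  rewrite mulr_sumr; apply: ler_sum_nat => n /andP[n0 _].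
  rewrite mulrA ler_wpM2r//.
  exact: kern_block_le (block_start_gt0 _) _ _ _.
rewrite ler_wpM2l//; exact: (hsum_ge p1 gp b0 bB _ (pos _ lj)).
Qed.

Lemma blockmean_ge0 (g : nat -> R[i]) j : 0 <= blockmean p d g j.
Proof. by rewrite mulr_ge0 ?invr_ge0// sumr_ge0// => k _; rewrite powR_ge0. Qed.

(** The bound [S_k ^ p <= growth ^ p * S_l ^ p] is averaged over [l] with the weights [|h_l| ^ p],
    whose sum is the block length [L]. It is then multiplied by [|g_k| ^ p] and summed over [k]. *)
Lemma block_le (g h : nat -> R[i]) (b : nat -> R) (B : R) j : (0 < j)%N ->
  (forall n, 0 <= b n) -> (forall N, \sum_(1 <= n < N) b n `^ p <= B) ->
  blockmean p d h j = 1 ->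
  \sum_(d j.-1 <= k < d j) (cabs (g k) * hsum gamma b k) `^ p <=
  (blockmean p d g j `^ p^-1 * growth j) `^ p *
    \sum_(d j.-1 <= k < d j) (cabs (h k) * hsum gamma b k) `^ p.
Proof.
move=> j0 b0 bB h1.
have pos k : (d j.-1 <= k < d j)%N -> (0 < k)%N.
  by case/andP => + _; apply: leq_trans; exact: block_start_gt0.
have dj : (d j.-1 < d j)%N by rewrite -[in ltnRHS](prednK j0).
set L : R := (d j - d j.-1)%N%:R.
have L0 : 0 < L by rewrite ltr0n subn_gt0.
have hL : \sum_(d j.-1 <= k < d j) cabs (h k) `^ p = L.
  move: h1; rewrite /blockmean -/L => /(congr1 ( *%R L)).
  by rewrite mulrA divff ?gt_eqF// mul1r mulr1.
have G0 : 0 <= growth j by rewrite le_max powR_ge0.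
set Y := \sum_(d j.-1 <= k < d j) (cabs (h k) * hsum gamma b k) `^ p.
have SY k : (d j.-1 <= k < d j)%N -> hsum gamma b k `^ p <= growth j `^ p * Y / L.
  move=> kj; rewrite ler_pdivlMr// -hL /Y !mulr_sumr.
  apply: ler_sum_nat => l lj.
  have hl0 := hsum_ge0 p1 gp b0 bB (pos _ lj).
  rewrite powRM ?cabs_ge0// mulrCA [leLHS]mulrC ler_wpM2l ?powR_ge0// -powRM//.
  apply: ler_powR2r => //; first exact: (hsum_ge0 p1 gp b0 bB (pos _ kj)).
  exact: hsum_block_le b0 bB kj lj.
rewrite powRM ?powR_ge0// powRVK ?blockmean_ge0//.
rewrite (_ : blockmean p d g j * growth j `^ p * Y =
  \sum_(d j.-1 <= k < d j) cabs (g k) `^ p * (growth j `^ p * Y / L)); last first.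
  by rewrite -mulr_suml /blockmean -/L; ring.
apply: ler_sum_nat => k kj.
rewrite powRM ?cabs_ge0 ?(hsum_ge0 p1 gp b0 bB (pos _ kj))//.
by rewrite ler_wpM2l ?powR_ge0// SY.
Qed.

Lemma in_lp_bound (a : nat -> R[i]) : in_lp p a ->
  exists B, [/\ 0 <= B, lpnorm p a = B%:E &
    forall N, \sum_(1 <= n < N) cabs (a n) `^ p <= B `^ p].
Proof.
rewrite /in_lp => a_lp; exists (fine (lpnorm p a)).
have nE : lpnorm p a = (fine (lpnorm p a))%:E.
  by rewrite fineK// ge0_fin_numE// poweR_ge0.
have n0 : 0 <= fine (lpnorm p a) by rewrite fine_ge0// poweR_ge0.
split=> // N.
by apply: (@tailnorm_powR_le _ _ 1 (fun n => cabs (a n))) => //; rewrite -nE.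
Qed.

Lemma eq_tailnorm (u v : nat -> R) m : (forall k, (m <= k)%N -> u k = v k) ->
  tailnorm p m u = tailnorm p m v.
Proof.
move=> uv; congr (_ `^ _)%E; congr (limn _); apply/funext => N.
by apply: eq_big_nat => k /andP[mk _]; rewrite uv.
Qed.

Lemma CK_upper (g h a : nat -> R[i]) K : (0 < K)%N -> in_lp p a ->
  (forall n, (0 < n)%N -> 0 <= a n) -> (forall n, (0 < n)%N -> blockmean p d h n = 1) ->
  (CK p gamma d K g a <= esup_from K (fun j => (blockmean p d g j `^ p^-1 * growth j)%R)
    * CK p gamma d K h a)%E.
Proof.
move=> K0 /in_lp_bound[B [B0 _ aB]] a0 h1.
set s := esup_from _ _.
have CKE f : CK p gamma d K f a =
    tailnorm p (d K.-1) (fun k => cabs (f k) * hsum gamma (fun n => cabs (a n)) k).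
  apply: (@eq_tailnorm (fun k => cabs (Hop gamma f a k))) => k dk.
  apply: (cabs_Hop_ge0E f p1 gp _ aB a0).
  by apply: leq_trans dk; exact: block_start_gt0.
have c0 j : 0 <= blockmean p d g j `^ p^-1 * growth j.
  by rewrite mulr_ge0 ?powR_ge0// le_max powR_ge0.
have sub j : (K <= j)%N -> ((blockmean p d g j `^ p^-1 * growth j)%:E <= s)%E.
  by move=> Kj; apply: ereal_sup_ubound; exists j.
have s0 : (0 <= s)%E by apply: le_trans (sub K (leqnn _)); rewrite lee_fin.
have hb j : (K <= j)%N -> _ := fun Kj => block_le g (leq_trans K0 Kj)
  (fun n => cabs_ge0 (a n)) aB (h1 j (leq_trans K0 Kj)).
rewrite !CKE.
set y := fun k => cabs (h k) * _; set x := fun k => cabs (g k) * _.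
(* The supremum may be infinite here; since the product with 0 is 0, the left side has to be shown
   to vanish. *)
have [T0|T0] := eqVneq (tailnorm p (d K.-1) y) 0%E.
  rewrite T0 mule0 -[leRHS](mul0e (tailnorm p (d K.-1) y)).
  apply: tailnorm_le_block => // j Kj; apply: le_trans (hb j Kj) _.
  have y0 : \sum_(d K.-1 <= k < d j) y k `^ p <= 0.
    by rewrite -[leRHS](powR0 (lt0r_neq0 p0)) tailnorm_powR_le// T0.
  have dKj : (d K.-1 <= d j.-1)%N.
    by apply: (homo_leq leqnn leq_trans (fun n => ltnW (hd n))); lia.
  have djj : (d j.-1 <= d j)%N.
    by rewrite -[in leqRHS](prednK (leq_trans K0 Kj)) ltnW.
  rewrite powR0 ?gt_eqF// mul0r mulr_ge0_le0 ?powR_ge0//.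
  apply: le_trans y0; rewrite [leRHS](big_cat_nat dKj djj)/= lerDr.
  by rewrite sumr_ge0// => k _; exact: powR_ge0.
(* For a nonzero tail norm, an infinite supremum makes the right side infinite. *)
case: s s0 sub => [s s0 sub|_ _|//]; last first.
  by rewrite gt0_mulye ?leey// lt_neqAle eq_sym T0 poweR_ge0.
apply: tailnorm_le_block => // j Kj.
apply: le_trans (hb j Kj) _; rewrite ler_wpM2r//.
  by rewrite sumr_ge0// => k _; exact: powR_ge0.
by apply: ler_powR2r => //; rewrite -lee_fin sub.
Qed.

End UpperBound.

(** * The test sequence *)

Section IntegralComparison.
Variable R : realType.
Local Notation mu := (@lebesgue_measure R).
Variables (F : R -> R) (c delta : R).
Hypotheses (F0 : forall x, c <= x -> 0 <= F x) (d0 : 0 < delta).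
Hypothesis F_ni : forall x y, c <= x -> x <= y -> F y <= F x.
Hypothesis mF : measurable_fun setT F.

Let A (i : nat) : set R := `[c + i%:R * delta, c + i.+1%:R * delta[%classic.

Let bigcupA : `[c, +oo[%classic = \bigcup_i A i.
Proof.
apply/seteqP; split=> [x|x [i _]]; rewrite /A /= !in_itv /=.
  rewrite andbT => cx; have t0 : 0 <= (x - c) / delta by rewrite divr_ge0 ?subr_ge0// ltW.
  exists (Num.truncn ((x - c) / delta)) => //=.
  have /andP[t1 t2] := Num.Theory.truncn_itv t0.
  rewrite in_itv/=; apply/andP; split.
    by move: t1; rewrite ler_pdivlMr// lerBrDl.
  by move: t2; rewrite ltr_pdivrMr// ltrBlDl.
by move=> /andP[+ _]; rewrite andbT; apply: le_trans; rewrite lerDl mulr_ge0// ltW.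
Qed.

Let trivA : trivIset setT A.
Proof.
apply: ltn_trivIset => i j ij; apply/seteqP; split=> [x|//] []; rewrite /A /= !in_itv /=.
move=> /andP[_ xj] /andP[ix _]; have := le_lt_trans ix xj.
by rewrite ltrD2l ltr_pM2r// ltr_nat ltnS leqNgt ij.
Qed.

Let muA i : mu (A i) = delta%:E.
Proof.
rewrite /A lebesgue_measure_itv/= lte_fin ltrD2l ltr_pM2r// ltr_nat ltnSn.
by rewrite -EFinD; congr EFin; rewrite -natr1; ring.
Qed.

Let integralE : (\int[mu]_(x in `[c, +oo[%classic) (F x)%:E =
  \sum_(i <oo) \int[mu]_(x in A i) (F x)%:E)%E.
Proof.
rewrite bigcupA ge0_integral_bigcup//.
- by move=> i; exact: measurable_itv.
- by apply/measurable_EFinP; exact: measurable_funTS mF.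
- move=> x; rewrite -bigcupA /= in_itv/= andbT => cx.
  by rewrite lee_fin F0.
Qed.

Let node i : c <= c + i%:R * delta.
Proof. by rewrite lerDl mulr_ge0// ltW. Qed.

(** On each cell of length [delta] the function is at least its value at the right end point; the
    next lemma uses the left one. *)
Lemma integral_ge_sum N :
  ((\sum_(0 <= i < N) delta * F (c + i.+1%:R * delta))%:E <=
   \int[mu]_(x in `[c, +oo[%classic) (F x)%:E)%E.
Proof.
have int0 i : (0 <= \int[mu]_(x in A i) (F x)%:E)%E.
  apply: integral_ge0 => x; rewrite /A /= in_itv/= => /andP[cx _].
  by rewrite lee_fin F0// (le_trans (node i)).
rewrite integralE; apply: le_trans (nneseries_lim_ge N (fun i _ _ => int0 i)).
rewrite -sumEFin; apply: lee_sum => i _.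
rewrite mulrC EFinM -(muA i) -integral_cst//; last exact: measurable_itv.
apply: ge0_le_integral => //; first exact: measurable_itv.
- by move=> x _; rewrite lee_fin F0.
- by apply/measurable_EFinP; exact: measurable_funTS mF.
- move=> x; rewrite /A /= in_itv/= => /andP[cx xc].
  by rewrite lee_fin F_ni ?(le_trans (node i))// ltW.
Qed.

Lemma integral_le_sum :
  (\int[mu]_(x in `[c, +oo[%classic) (F x)%:E <=
   \sum_(i <oo) (delta * F (c + i%:R * delta))%:E)%E.
Proof.
rewrite integralE; apply: lee_nneseries => [i _ _|i _].
  apply: integral_ge0 => x; rewrite /A /= in_itv/= => /andP[cx _].
  by rewrite lee_fin F0// (le_trans (node i)).
rewrite mulrC EFinM -(muA i) -integral_cst//; last exact: measurable_itv.
apply: ge0_le_integral => //; first exact: measurable_itv.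
- by move=> x; rewrite /A /= in_itv/= => /andP[cx _]; rewrite lee_fin F0// (le_trans (node i)).
- by apply/measurable_EFinP; exact: measurable_funTS mF.
- by move=> x; rewrite /A /= in_itv/= => /andP[cx _]; rewrite lee_fin F_ni.
Qed.

End IntegralComparison.

(** * Lower bounds for elementary sums *)

Section ElementarySums.
Variable R : realType.

Lemma sum_ge_const (f : nat -> R) (x : R) (m n : nat) :
  (forall i, (m <= i < n)%N -> x <= f i) ->
  (n - m)%:R * x <= \sum_(m <= i < n) f i.
Proof.
move=> xf; rewrite mulr_natl -sumr_const_nat; exact: ler_sum_nat.
Qed.

(** On the ranges up to [k], [2k] and [3k] the terms are at least [1/(2k)], [1/(3k)] and [1/(4k)].
    The first range starts at the ceiling [m] of [k/3]. The constant 3/4 is the one that later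
    produces [3 * F 3]. *)
Lemma sum_inv_ge (k : nat) : (0 < k)%N ->
  3 / 4 <= \sum_(1 <= n < (3 * k)%N | (k <= 3 * n)%N) ((n + k)%:R)^-1 :> R.
Proof.
move=> k0; have K0 : 0 < (k%:R : R) by rewrite ltr0n.
pose m := ((k + 2) %/ 3)%N.
have m3 : (k <= 3 * m)%N by rewrite /m; lia.
have m1 : (0 < m)%N by lia.
have mk : (m <= k.+1)%N by lia.
have mk3 : (3 * m <= k + 2)%N by rewrite /m; lia.
have inv_le (n l : nat) : (0 < n)%N -> (n <= l)%N -> (l%:R^-1 <= n%:R^-1 :> R).
  by move=> n0 nl; rewrite lef_pV2 ?posrE ?ltr0n ?(leq_trans n0)// ler_nat.
rewrite (big_cat_nat m1); last by lia.
rewrite /= (@big_cat_nat _ _ _ k.+1 m)//; last by lia.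
rewrite /= (@big_cat_nat _ _ _ (2 * k).+1 k.+1); [|lia|lia].
rewrite /= -[leLHS]add0r; apply: lerD.
  by apply: sumr_ge0 => n _; rewrite invr_ge0.
have drop a b : (m <= a)%N -> \sum_(a <= n < b | (k <= 3 * n)%N) ((n + k)%:R)^-1 =
    \sum_(a <= n < b) ((n + k)%:R)^-1 :> R.
  move=> ma; rewrite big_nat_cond [RHS]big_nat_cond; apply: eq_bigl => n.
  by rewrite andbT; case: (leqP a n) => //= an; rewrite (_ : (k <= 3 * n)%N) ?andbT//; lia.
rewrite !drop ?leqnn//; [|lia].
have h1 := @sum_ge_const (fun n => ((n + k)%:R)^-1) ((2 * k)%:R^-1) m k.+1.
have h2 := @sum_ge_const (fun n => ((n + k)%:R)^-1) ((3 * k)%:R^-1) k.+1 (2 * k).+1.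
have h3 := @sum_ge_const (fun n => ((n + k)%:R)^-1) ((4 * k)%:R^-1) (2 * k).+1 (3 * k).
have a1 : (2 * k + 1)%:R / 3 * (2 * k)%:R^-1 <= \sum_(m <= n < k.+1) ((n + k)%:R)^-1 :> R.
  apply: le_trans (h1 _).
    rewrite ler_wpM2r ?invr_ge0// ler_pdivrMr// -natrM ler_nat; lia.
  by move=> i /andP[_ ik]; apply: inv_le; lia.
have a2 : k%:R * (3 * k)%:R^-1 <= \sum_(k.+1 <= n < (2 * k).+1) ((n + k)%:R)^-1 :> R.
  apply: le_trans (h2 _).
    rewrite ler_wpM2r ?invr_ge0// ler_nat; lia.
  by move=> i /andP[_ ik]; apply: inv_le; lia.
have a3 : (k%:R - 1) * (4 * k)%:R^-1 <= \sum_((2 * k).+1 <= n < (3 * k)%N) ((n + k)%:R)^-1 :> R.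
  apply: le_trans (h3 _).
    rewrite ler_wpM2r ?invr_ge0// -(natrB _ k0) ler_nat; lia.
  by move=> i /andP[_ ik]; apply: inv_le; lia.
apply: le_trans (lerD a1 (lerD a2 a3)).
rewrite natrD !natrM.
have -> : (2 * k%:R + 1%:R) / 3 * (2 * k%:R)^-1 +
  (k%:R / (3 * k%:R) + (k%:R - 1) / (4 * k%:R)) = 3 / 4 + (2 - k%:R^-1) / 12 :> R.
  by field; rewrite gt_eqF.
have : k%:R^-1 <= 1 :> R by rewrite invf_le1// ler1n.
by move=> k1; rewrite lerDl divr_ge0// subr_ge0 (le_trans k1)// ler1n.
Qed.

End ElementarySums.

(** * One sequence that makes all S_k with k <= D large *)

Section TestSequence.
Variable R : realType.

Lemma sum_shift (f : nat -> R) (a N : nat) :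
  \sum_(a <= i < a + N) f i = \sum_(0 <= i < N) f (i + a)%N.
Proof. by rewrite -{1}[a]add0n big_addn addKn. Qed.

Local Notation mu := (@lebesgue_measure R).
Variables (p q gamma : R).
Hypotheses (p1 : 1 < p) (pq : p^-1 + q^-1 = 1) (gp : - p^-1 < gamma < 1 - p^-1).

Let p0 : 0 < p. Proof. exact: lt_trans ltr01 p1. Qed.

Let q1 : 1 < q.
Proof.
have ip1 : p^-1 < 1 by rewrite invf_lt1.
have ip0 : 0 < p^-1 by rewrite invr_gt0.
have iq0 : 0 < q^-1 by rewrite -(ltrD2l p^-1) addr0 pq.
have q0 : 0 < q by rewrite -invr_gt0.
by rewrite -invf_lt1// -(ltrD2l p^-1) pq ltrDr.
Qed.

Let q0 : 0 < q. Proof. exact: lt_trans ltr01 q1. Qed.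

(** This is why the test sequence is a power [q - 1] of [H]: its p-th power is [H ^ q], the
    integrand of the statement. *)
Let pq1 : (q - 1) * p = q.
Proof.
have : (p^-1 + q^-1) * (p * q) = p * q by rewrite pq mul1r.
have -> : (p^-1 + q^-1) * (p * q) = q + p by field; rewrite !gt_eqF.
by move=> h; rewrite mulrBl mul1r mulrC -h addrK.
Qed.

Let r : R := `|gamma|.

Let H (x : R) : R := x `^ (- r) / (1 + x).

Let H_ge0 x : 0 <= x -> 0 <= H x.
Proof. by move=> x0; rewrite divr_ge0 ?powR_ge0// addr_ge0. Qed.

Let H_gt0 x : 0 < x -> 0 < H x.
Proof. by move=> x0; rewrite divr_gt0 ?powR_gt0// addr_gt0. Qed.

Let H_ni x y : 0 < x -> x <= y -> H y <= H x.
Proof.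
move=> x0 xy; have y0 : 0 < y by apply: lt_le_trans xy.
apply: ler_pM; rewrite ?powR_ge0 ?invr_ge0 ?addr_ge0 ?(ltW y0)//.
  rewrite !powRN lef_pV2 ?posrE ?powR_gt0//.
  have [->|r0] := eqVneq r 0; first by rewrite !powRr0.
  by apply: ler_powR2r; rewrite ?(ltW x0)// lt_neqAle eq_sym r0 normr_ge0.
by rewrite lef_pV2 ?posrE ?addr_gt0// lerD2l.
Qed.

Definition tail_density (x : R) : R := x `^ (- (`|gamma| * q)) / (1 + x) `^ q.
Local Notation F := tail_density.

Let FE x : 0 <= x -> F x = H x `^ q.
Proof.
move=> x0; have x10 : 0 <= 1 + x by rewrite addr_ge0.
by rewrite /H powRM ?powR_ge0 ?invr_ge0// -powRrM powRV// powRN mulNr.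
Qed.

Let F_ge0 x : 0 <= F x.
Proof. by rewrite divr_ge0 ?powR_ge0. Qed.

Let F_ni x y : 0 < x -> x <= y -> F y <= F x.
Proof.
move=> x0 xy; have y0 : 0 < y by apply: lt_le_trans xy.
by rewrite !FE ?(ltW x0) ?(ltW y0)//; apply: ler_powR2r; rewrite ?H_ge0 ?(ltW y0)// H_ni.
Qed.

Let mF : measurable_fun setT F.
Proof.
apply: measurable_funM; first exact: measurable_powR.
rewrite (_ : (fun x => _) = (fun x => (1 + x) `^ (- q))); last first.
  by apply/funext => x; rewrite powRN.
apply: (measurableT_comp (measurable_powR _)).
exact: measurable_funD.
Qed.

Definition tail_integral : \bar R := (\int[mu]_(x in `[3%R, +oo[%classic) (F x)%:E)%E.

Let lower (delta : R) N : 0 < delta ->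
  ((\sum_(0 <= i < N) delta * F (3 + i.+1%:R * delta))%:E <= tail_integral)%E.
Proof.
move=> delta0; apply: integral_ge_sum => // [x y x3 xy].
by apply: F_ni => //; apply: lt_le_trans x3.
Qed.

Let upper (delta : R) : 0 < delta ->
  (tail_integral <= \sum_(i <oo) (delta * F (3 + i%:R * delta))%:E)%E.
Proof.
move=> delta0; apply: integral_le_sum => // [x y x3 xy].
by apply: F_ni => //; apply: lt_le_trans x3.
Qed.

Let upper_le (delta B : R) : 0 < delta ->
  (forall N, \sum_(0 <= i < N) delta * F (3 + i%:R * delta) <= B) ->
  (tail_integral <= B%:E)%E.
Proof.
move=> delta0 hB; apply: le_trans (upper delta0) _; apply: lime_le.
  by apply: is_cvg_nneseries => i _ _; rewrite lee_fin mulr_ge0// ltW.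
by apply: nearW => N; rewrite sumEFin lee_fin.
Qed.

Lemma tail_integral_gt0 : (0 < tail_integral)%E.
Proof.
apply: lt_le_trans (lower 1 ltr01); rewrite big_nat1 lte_fin mul1r.
by rewrite divr_gt0 ?powR_gt0// ?addr_gt0// mulr_gt0.
Qed.

Lemma tail_integral_lty : (tail_integral < +oo)%E.
Proof.
have s0 : 0 < q - 1 by rewrite subr_gt0.
suff hB N : \sum_(0 <= i < N) 1 * F (3 + i%:R * 1) <= (q - 1)^-1.
  exact: le_lt_trans (upper_le ltr01 hB) (ltry _).
(* The bound is sharpened by a telescoping term for the induction, which uses
   [F (3 + N) <= (N + 2) ^ (- q)]. *)
apply: (@le_trans _ _ ((q - 1)^-1 * (1 - N.+1%:R `^ (- (q - 1))))); last first.
  by rewrite ler_piMr ?invr_ge0 ?(ltW s0)// gerBl powR_ge0.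
elim: N => [|N IH]; first by rewrite big_geq// powR1 subrr mulr0.
rewrite big_nat_recr//=; apply: (le_trans (lerD IH (lexx _))).
rewrite -lerBrDl -mulrBr mul1r mulr1 mulrC ler_pdivlMr// mulrC.
rewrite (_ : 1 - _ - (1 - _) = N.+1%:R `^ (- (q - 1)) - N.+2%:R `^ (- (q - 1))); last by ring.
apply: le_trans (powRN_diff_ge s0 (ltn0Sn N)).
rewrite ler_pM2l// (_ : - (q - 1) - 1 = - q); last by ring.
rewrite /F powRN; have x1 : 1 <= 3 + N%:R :> R by rewrite -natrD ler1n.
have x0 : 0 < 3 + N%:R :> R by apply: lt_le_trans x1.
apply: (@le_trans _ _ (((1 + (3 + N%:R)) `^ q)^-1)).
  rewrite ler_piMl ?invr_ge0 ?powR_ge0// powRN invf_le1 ?powR_gt0//.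
  rewrite -[leLHS](powRr0 (3 + N%:R)); apply: ler_powR => //.
  by rewrite mulr_ge0// ltW.
have y0 : 0 < 1 + (3 + N%:R) :> R by rewrite addr_gt0.
rewrite lef_pV2 ?posrE ?powR_gt0//; apply: ler_powR2r => //.
by rewrite -!natr1; lra.
Qed.

Lemma tail_integralE : tail_integral = (fine tail_integral)%:E.
Proof. by rewrite fineK// ge0_fin_numE ?tail_integral_lty// ltW ?tail_integral_gt0. Qed.

Local Notation I := (fine tail_integral).

Let I_ge0 : 0 <= I.
Proof. by rewrite -lee_fin -tail_integralE ltW ?tail_integral_gt0. Qed.

(* With the plateau up to 3, the head of the sum over [n] can be bounded using only
   [k <= 3 n < 9 k], where [(k / n) ^ gamma >= 3 ^ - |gamma|] for either sign of
   [gamma]. *)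
Let phi (x : R) : R := H (Num.max x 3) `^ (q - 1).

Let max3 (x : R) : 0 < Num.max x 3.
Proof. by rewrite lt_max ltr0n orbT. Qed.

Let phi_gt0 x : 0 < phi x.
Proof. by rewrite powR_gt0// H_gt0. Qed.

Let phi_ni x y : x <= y -> phi y <= phi x.
Proof.
move=> xy; apply: ler_powR2r; rewrite ?subr_gt0 ?H_ge0 ?(ltW (max3 _))//.
by apply: H_ni => //; rewrite ge_max !le_max xy lexx orbT.
Qed.

Let phi_powR x : phi x `^ p = F (Num.max x 3).
Proof. by rewrite -powRrM pq1 FE// ltW. Qed.

(** The same quantity serves twice: [D * Y] bounds the p-th power of the norm of the test sequence
    from above, and [Y] bounds each of its sums S_k from below. The term [3 * F 3] comes from the
    plateau. *)
Let Y : R := 3 * F 3 + I.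

Let Y_gt0 : 0 < Y.
Proof.
rewrite ltr_wpDr// mulr_gt0// FE// powR_gt0//; exact: H_gt0.
Qed.

Section Scale.
Variable D : nat.
Hypothesis D0 : (0 < D)%N.

Let D0' : 0 < (D%:R : R). Proof. by rewrite ltr0n. Qed.

Let c (n : nat) : R := phi (n%:R / D%:R).

Let c_gt0 n : 0 < c n. Proof. exact: phi_gt0. Qed.

Let sum_c_le N : \sum_(1 <= n < N) c n `^ p <= D%:R * Y.
Proof.
have t0 n : 0 <= c n `^ p by exact: powR_ge0.
apply: (@le_trans _ _ (\sum_(1 <= n < (3 * D).+1 + N) c n `^ p)).
  case: N => [|N]; first by rewrite big_geq// sumr_ge0.
  have NN : (N.+1 <= (3 * D).+1 + N.+1)%N by exact: leq_addl.
  by rewrite [leRHS](big_cat_nat _ NN)//= lerDl sumr_ge0.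
have m1 : (1 <= (3 * D).+1)%N by [].
have m2 : ((3 * D).+1 <= (3 * D).+1 + N)%N by exact: leq_addr.
rewrite (big_cat_nat m1 m2)/= /Y mulrDr; apply: lerD.
  apply: (@le_trans _ _ (\sum_(1 <= n < (3 * D).+1) F 3)).
    apply: ler_sum_nat => n /andP[_ n3]; rewrite phi_powR max_r//.
    by rewrite ler_pdivrMr// -natrM ler_nat -ltnS.
  by rewrite sumr_const_nat subSS subn0 -[leLHS]mulr_natl natrM mulrA [D%:R * 3]mulrC.
(* Beyond the plateau the p-th powers form a right end point sum of mesh [1/D], hence stay below
   [D * I]. *)
have dD : 0 < D%:R^-1 :> R by rewrite invr_gt0.
have h := lower N dD; rewrite tail_integralE lee_fin -(ler_pM2l D0') in h.
apply: le_trans h; rewrite mulr_sumr sum_shift.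
apply: ler_sum_nat => i _; rewrite mulrA divff ?gt_eqF// mul1r phi_powR.
have -> : (i + (3 * D).+1)%:R / D%:R = 3 + i.+1%:R * D%:R^-1 :> R.
  by rewrite addnS -addSn natrD natrM; field; rewrite gt_eqF.
by rewrite max_l// lerDl mulr_ge0// ltW.
Qed.

(** Here [k/n <= 1], so replacing [gamma] by [|gamma|] can only lower the power. *)
Let kern_ge_tail (k n : nat) : (0 < k)%N -> (3 * k <= n)%N ->
  H (n%:R / k%:R) / k%:R <= kern gamma k n.
Proof.
move=> k0 kn; have K0 : 0 < (k%:R : R) by rewrite ltr0n.
have n0 : (0 < n)%N by clear -k0 kn; lia.
have N0 : 0 < (n%:R : R) by rewrite ltr0n.
rewrite /kern /H -mulrA -invfM.
have -> : (1 + n%:R / k%:R) * k%:R = (n + k)%:R :> R.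
  by rewrite natrD; field; rewrite gt_eqF.
rewrite ler_wpM2r ?invr_ge0// -powRV ?divr_ge0// invf_div.
apply: ger_powR; last exact: ler_norm.
by rewrite divr_gt0//= ler_pdivrMr// mul1r ler_nat; clear -kn; lia.
Qed.

Let kern_ge_head (k n : nat) : (0 < k)%N -> (k <= 3 * n)%N -> (n < 3 * k)%N ->
  3 `^ (- r) / (n + k)%:R <= kern gamma k n.
Proof.
move=> k0 kn nk; have K0 : 0 < (k%:R : R) by rewrite ltr0n.
have n0 : (0 < n)%N by clear -k0 kn; lia.
have N0 : 0 < (n%:R : R) by rewrite ltr0n.
rewrite /kern ler_wpM2r ?invr_ge0//.
rewrite /powR !gt_eqF ?divr_gt0// ler_expR mulNr lerNl.
apply: (le_trans (ler_norm _)); rewrite normrN normrM ler_wpM2l//.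
have kn3 : 0 < (k%:R / n%:R : R) by rewrite divr_gt0.
rewrite ler_norml -lnV ?posrE// !ler_ln ?posrE ?invr_gt0//.
rewrite ler_pdivlMr// mulrC ler_pdivrMr// ler_pdivrMr// -!natrM !ler_nat.
by apply/andP; split; clear -kn nk; lia.
Qed.

(** The sum is split at [n = 3k]. Since [k <= D] and [phi] is nonincreasing, [c n] is at least
    [phi (n/k)]. The tail then becomes a left end point sum of [F] with mesh [1/k], because
    [H * H ^ (q - 1) = F]. *)
Let hsum_c_ge k N : (0 < k <= D)%N ->
  3 * F 3 + \sum_(0 <= i < N) k%:R^-1 * F (3 + i%:R * k%:R^-1) <=
  \sum_(1 <= n < 3 * k + N) kern gamma k n * c n.
Proof.
move=> /andP[k0 kD]; have K0 : 0 < (k%:R : R) by rewrite ltr0n.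
have m1 : (1 <= 3 * k)%N by rewrite muln_gt0.
have m2 : (3 * k <= 3 * k + N)%N by exact: leq_addr.
rewrite (big_cat_nat m1 m2)/=; apply: lerD.
  have h0 n : 0 <= kern gamma k n * c n by rewrite mulr_ge0 ?kern_ge0// ltW.
  apply: (@le_trans _ _ (\sum_(1 <= n < (3 * k)%N | (k <= 3 * n)%N)
     3 `^ (- r) / (n + k)%:R * phi 3)); last first.
    rewrite [leRHS](bigID (fun n => k <= 3 * n)%N)/= -[leLHS]addr0 lerD ?sumr_ge0//.
    rewrite big_nat_cond [leRHS]big_nat_cond; apply: ler_sum => n /andP[/andP[n0 nk] kn].
    apply: ler_pM; [by rewrite divr_ge0 ?powR_ge0 | exact: ltW | exact: kern_ge_head |].
    apply: phi_ni; rewrite ler_pdivrMr// -natrM ler_nat.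
    by apply: leq_trans (ltnW nk) _; rewrite leq_mul2l kD orbT.
  rewrite -mulr_suml -mulr_sumr.
  have := ler_wpM2r (ltW (phi_gt0 3)) (ler_wpM2l (powR_ge0 3 (- r)) (sum_inv_ge R k0)).
  apply: le_trans; rewrite /phi max_r// FE// -(mulr_powRB1 (H_ge0 (ler0n _ 3)) q0).
  (* Equality: [3 ^ (- r) * (3/4)] is [3 * H 3]. *)
  rewrite mulrA ler_wpM2r ?powR_ge0// /H le_eqVlt; apply/orP; left; apply/eqP.
  by field.
rewrite (sum_shift _ (3 * k)).
apply: ler_sum_nat => i _.
have xE : (i + 3 * k)%:R / k%:R = 3 + i%:R * k%:R^-1 :> R.
  by rewrite natrD natrM; field; rewrite gt_eqF.
have x3 : 3 <= 3 + i%:R * k%:R^-1 :> R by rewrite lerDl mulr_ge0// ltW// invr_gt0.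
have x0 : 0 <= 3 + i%:R * k%:R^-1 :> R by apply: le_trans x3.
have k1 := kern_ge_tail k0 (leq_addl i (3 * k)).
apply: (@le_trans _ _ (H ((i + 3 * k)%:R / k%:R) / k%:R * phi ((i + 3 * k)%:R / k%:R))).
  rewrite xE /phi max_l// FE// -(mulr_powRB1 (H_ge0 x0) q0).
  by rewrite le_eqVlt; apply/orP; left; apply/eqP; ring.
apply: ler_pM => //.
- by rewrite divr_ge0 ?ler0n ?H_ge0 ?divr_ge0.
- exact: ltW.
- apply: phi_ni; rewrite ler_wpM2l// lef_pV2 ?posrE// ler_nat//.
Qed.

(** Normalising [c] by its norm, at most [(D * Y) ^ (1/p)], leaves sums of size at least
    [D ^ (- 1/p) * Y ^ (1/q)], and [Y >= I]. *)
Lemma test_sequence : exists b : nat -> R, [/\ forall n, 0 <= b n,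
  tailnorm p 1 b = 1%E & forall k, (0 < k <= D)%N ->
  D%:R `^ (- p^-1) * I `^ q^-1 <= hsum gamma b k].
Proof.
have T0 := tailnorm_le (m := 1) p0 sum_c_le.
have T1 : (0 < tailnorm p 1 c)%E.
  apply: lt_le_trans (tailnorm_ge 1 c 2 p0).
  by rewrite big_nat1 lte_fin powR_gt0// powR_gt0.
have TE : tailnorm p 1 c = (fine (tailnorm p 1 c))%:E.
  by rewrite fineK// ge0_fin_numE ?(ltW T1)// (le_lt_trans T0)// ltry.
set T := fine (tailnorm p 1 c) in TE.
have T_gt0 : 0 < T by rewrite -lte_fin -TE.
have TD : T <= (D%:R * Y) `^ p^-1 by rewrite -lee_fin -TE.
pose b n := T^-1 * c n.
have b0 n : 0 <= b n by rewrite mulr_ge0 ?invr_ge0 ?(ltW T_gt0) ?(ltW (c_gt0 _)).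
have bE n : b n `^ p = (T^-1) `^ p * c n `^ p.
  by rewrite powRM ?invr_ge0 ?(ltW T_gt0) ?(ltW (c_gt0 _)).
exists b; split=> //.
  rewrite /tailnorm (_ : (fun N => _) = (fun N => \sum_(1 <= k < N)
      (((T^-1) `^ p)%:E * ((c k `^ p)%R)%:E)%E)); last first.
    by apply/funext => N; apply: eq_bigr => k _; rewrite bE EFinM.
  rewrite nneseriesZl; last by move=> i _; rewrite lee_fin powR_ge0.
  rewrite poweRM ?lee_fin ?powR_ge0//; last first.
    by apply: nneseries_ge0 => i _ _; rewrite lee_fin powR_ge0.
  rewrite -/(tailnorm p 1 c) TE poweR_EFin powRK ?invr_ge0 ?(ltW T_gt0)//.
  by rewrite -EFinM mulVf ?gt_eqF.
move=> k kD; have /andP[k0 _] := kD.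
have bB N : \sum_(1 <= n < N) b n `^ p <= T^-1 `^ p * (D%:R * Y).
  under eq_bigr do rewrite bE.
  by rewrite -mulr_sumr ler_wpM2l ?powR_ge0.
have hb := hsum_ge p1 gp b0 bB _ k0.
have cb N : \sum_(1 <= n < N) kern gamma k n * c n <= T * hsum gamma b k.
  have := ler_wpM2l (ltW T_gt0) (hb N); apply: le_trans.
  rewrite mulr_sumr; apply: ler_sum => n _.
  by rewrite /b mulrCA (mulrA T) divff ?gt_eqF// mul1r.
(* All left end point sums of mesh [1/k] are bounded by the right side minus [3 * F 3], so the
   integral is too. *)
have YT : Y <= T * hsum gamma b k.
  rewrite /Y -lerBrDl -lee_fin -tail_integralE.
  apply: (@upper_le k%:R^-1); first by rewrite invr_gt0 ltr0n.
  by move=> N; rewrite lerBrDl; apply: le_trans (cb (3 * k + N)%N); exact: hsum_c_ge.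
have h0 := hsum_ge0 p1 gp b0 bB k0.
have {}YT : Y <= (D%:R * Y) `^ p^-1 * hsum gamma b k.
  by apply: le_trans YT _; rewrite ler_wpM2r.
have DYp : 0 < (D%:R * Y) `^ p^-1 by rewrite powR_gt0// mulr_gt0.
rewrite -(ler_pM2l DYp); apply: le_trans YT.
rewrite powRM ?(ltW Y_gt0)// powRN.
have -> : D%:R `^ p^-1 * Y `^ p^-1 * ((D%:R `^ p^-1)^-1 * I `^ q^-1) =
  Y `^ p^-1 * I `^ q^-1 by field; rewrite gt_eqF// powR_gt0.
apply: (@le_trans _ _ (Y `^ p^-1 * Y `^ q^-1)).
  rewrite ler_wpM2l ?powR_ge0//; apply: ler_powR2r; rewrite ?invr_gt0//.
  by rewrite lerDr mulr_ge0.
by rewrite -powR_addr// pq powRr1// ltW.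
Qed.

End Scale.
End TestSequence.

(** * Boundedness criteria *)

Section Boundedness.
Variable R : realType.
Variables (p q gamma : R) (d : nat -> nat).
Hypotheses (p1 : 1 < p) (pq : p^-1 + q^-1 = 1) (gp : - p^-1 < gamma < 1 - p^-1).
Hypotheses (hd : forall n, (d n < d n.+1)%N) (hd0 : d 0%N = 1%N).
Implicit Types (g a : nat -> R[i]) (b : nat -> R).

Let p0 : 0 < p. Proof. exact: lt_trans ltr01 p1. Qed.

Let dpos j : (0 < d j)%N. Proof. exact: (block_start_gt0 hd hd0). Qed.

Let dmono i j : (i <= j)%N -> (d i <= d j)%N.
Proof. by apply: (homo_leq leqnn leq_trans) => n; exact: ltnW. Qed.

Let djpred j : (0 < j)%N -> (d j.-1 < d j)%N.
Proof. by case: j. Qed.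

Local Notation c := (fine (tail_integral q gamma) `^ q^-1).

Let c_gt0 : 0 < c.
Proof.
by apply: powR_gt0; rewrite -lte_fin -(tail_integralE gamma p1 pq) (tail_integral_gt0 gamma p1 pq).
Qed.

Lemma CK_real_ge0 g b K : (forall n, 0 <= b n) -> tailnorm p 1 b = 1%E ->
  CK p gamma d K g (fun n => (b n)%:C) =
  tailnorm p (d K.-1) (fun k => cabs (g k) * hsum gamma b k).
Proof.
move=> b0 b1; apply: (@eq_tailnorm _ _ (fun k => cabs (Hop gamma g (fun n => (b n)%:C) k))).
move=> k dk; have k0 : (0 < k)%N by apply: leq_trans dk.
have bE : (fun n => cabs (b n)%:C) = b by apply/funext => n; rewrite cabs_real ger0_norm.
rewrite (@cabs_Hop_ge0E _ p _ _ _ (1 `^ p))// ?bE//.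
  move=> N; under eq_bigr do rewrite cabs_real ger0_norm//.
  by apply: tailnorm_powR_le; rewrite ?b1.
by move=> n _; rewrite lecR.
Qed.

(** For the test sequence with [D = d j], the bound [S_k ^ p >= c ^ p / d j] holds on the whole
    block, so it factors out of the sum of [|g_k| ^ p]. *)
Lemma block_lower g j : (0 < j)%N -> exists b, [/\ forall n, 0 <= b n,
  tailnorm p 1 b = 1%E &
  blockmean p d g j * (((d j)%:R - (d j.-1)%:R) / (d j)%:R) * c `^ p <=
  \sum_(d j.-1 <= k < d j) (cabs (g k) * hsum gamma b k) `^ p].
Proof.
move=> j0; have [b [b0 b1 hb]] := test_sequence p1 pq gp (dpos j).
exists b; split=> //; have dj := djpred j0.
have D0 : 0 < ((d j)%:R : R) by rewrite ltr0n.
have L0 : 0 < ((d j - d j.-1)%N%:R : R) by rewrite ltr0n subn_gt0.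
rewrite -natrB ?(ltnW dj)// /blockmean.
rewrite (_ : _ * _ * _ = \sum_(d j.-1 <= k < d j) cabs (g k) `^ p *
    ((d j)%:R^-1 * c `^ p)); last first.
  by rewrite -mulr_suml; field; rewrite !gt_eqF.
apply: ler_sum_nat => k /andP[jk kj].
have k0 : (0 < k)%N by apply: leq_trans jk.
have h := hb k; rewrite k0 (ltnW kj) in h.
have Dp : 0 <= (d j)%:R `^ (- p^-1) * c by rewrite mulr_ge0 ?powR_ge0 ?(ltW c_gt0).
rewrite powRM ?cabs_ge0 ?(le_trans Dp (h isT))// ler_wpM2l ?powR_ge0//.
apply: le_trans (ler_powR2r p0 Dp (h isT)).
by rewrite powRM ?powR_ge0 ?(ltW c_gt0)// powRNVK ?(ltW D0).
Qed.

Lemma CK_lower g K : (0 < K)%N ->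
  (esup_from K (fun j => (blockmean p d g j `^ p^-1 *
     (((d j)%:R - (d j.-1)%:R) / (d j)%:R) `^ p^-1)%R) * tail_integral q gamma `^ q^-1
   <= ereal_sup [set CK p gamma d K g a | a in [set a | lpnorm p a = 1%E]])%E.
Proof.
move=> K0; rewrite (tail_integralE gamma p1 pq) poweR_EFin muleC /esup_from.
rewrite -ereal_sup_pZl//; apply: ge_ereal_sup => _ [_ [j /= Kj <-] <-].
have j0 : (0 < j)%N by apply: leq_trans Kj.
have [b [b0 b1 hb]] := block_lower g j0.
apply: le_ereal_sup_tmp; exists (CK p gamma d K g (fun n => (b n)%:C)).
  exists (fun n => (b n)%:C) => //=; rewrite -b1 /lpnorm.
  apply: (@eq_tailnorm _ _ (fun k => cabs (b k)%:C)) => k _.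
  by rewrite cabs_real ger0_norm.
rewrite CK_real_ge0//; apply: le_trans (tailnorm_ge _ _ (d j) p0).
have dj := djpred j0.
have t0 : 0 <= ((d j)%:R - (d j.-1)%:R) / (d j)%:R :> R.
  by rewrite divr_ge0// subr_ge0 ler_nat ltnW.
have Gt0 := mulr_ge0 (blockmean_ge0 p d g j) t0.
rewrite -EFinM lee_fin -powRM ?blockmean_ge0// mulrC.
rewrite -[X in _ * X <= _](powRK p0 (ltW c_gt0)) -powRM ?powR_ge0//.
apply: ler_powR2r; [by rewrite invr_gt0 | by apply: mulr_ge0; rewrite ?powR_ge0 |].
apply: le_trans hb _.
have KK : (d K.-1 <= d j.-1)%N by apply: dmono; clear -Kj K0; lia.
rewrite [leRHS](big_cat_nat KK (ltnW dj))/= lerDr.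
by rewrite sumr_ge0// => k _; exact: powR_ge0.
Qed.

(** Reduces boundedness to finite sums with nonnegative coefficients, by passing to the moduli of
    [a]. *)
Lemma Hbounded_of_sum g (M : R) : 0 <= M ->
  (forall b (B : R), 0 <= B -> (forall n, 0 <= b n) ->
     (forall N, \sum_(1 <= n < N) b n `^ p <= B `^ p) ->
     forall N, \sum_(1 <= k < N) (cabs (g k) * hsum gamma b k) `^ p <= (M * B) `^ p) ->
  Hbounded p gamma g.
Proof.
move=> M0 hM; exists M => a /(in_lp_bound p1)[B [B0 -> aB]].
split=> [k k0|]; first exact: (is_cvg_Hpartial p1 gp k0 aB).
have aB' := hM _ _ B0 (fun n => cabs_ge0 (a n)) aB.
rewrite -EFinM -[M * B](powRK p0) ?mulr_ge0//.
apply: (@tailnorm_le _ p 1 (fun k => cabs (Hop gamma g a k))) => // N.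
apply: le_trans (aB' N); apply: ler_sum_nat => k /andP[k0 _].
by apply: ler_powR2r; rewrite ?cabs_ge0//; exact: (cabs_Hop_le g p1 gp k0 aB).
Qed.

Lemma Hbounded_sum g : Hbounded p gamma g -> exists M : R, 0 <= M /\
  forall b, (forall n, 0 <= b n) -> tailnorm p 1 b = 1%E ->
  forall N, \sum_(1 <= k < N) (cabs (g k) * hsum gamma b k) `^ p <= M `^ p.
Proof.
(* The bound in [Hbounded] carries no sign condition, hence the maximum with 0. *)
move=> [M hM]; exists (Num.max M 0); rewrite le_max lexx orbT; split=> // b b0 b1 N.
have bE : lpnorm p (fun n => (b n)%:C) = 1%E.
  rewrite -b1; apply: (@eq_tailnorm _ _ (fun k => cabs (b k)%:C)) => k _.
  by rewrite cabs_real ger0_norm.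
have b_lp : in_lp p (fun n => (b n)%:C) by rewrite /in_lp bE ltry.
have [_] := hM _ b_lp; rewrite bE mule1 => hle.
apply: tailnorm_powR_le; rewrite ?le_max ?lexx ?orbT//.
have := CK_real_ge0 g 1 b0 b1; rewrite hd0 => <-.
rewrite /CK /= hd0; apply: le_trans hle _.
by rewrite lee_fin le_max lexx.
Qed.

Lemma esup_from_lty (F : nat -> R) (B : R) :
  (forall j, (0 < j)%N -> F j <= B) -> (esup_from 1 F < +oo)%E.
Proof.
move=> FB; apply: le_lt_trans (ltry B); apply: ge_ereal_sup => _ [j j0 <-].
by rewrite lee_fin FB.
Qed.

Lemma esup_fromP (F : nat -> R) : (esup_from 1 F < +oo)%E ->
  exists B : R, forall j, (0 < j)%N -> F j <= B.
Proof.
rewrite /esup_from => Foo.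
have ub j : (0 < j)%N -> ((F j)%:E <= esup_from 1 F)%E.
  by move=> j0; apply: ereal_sup_ubound; exists j.
move: Foo ub; rewrite -/(esup_from 1 F); case: (esup_from 1 F) => [B _ ub|//|_ ub].
  by exists B => j j0; rewrite -lee_fin ub.
by have := ub 1%N isT; rewrite leeNy_eq.
Qed.

Let dratio_gt1 j : (0 < j)%N -> 1 < dratio R d j.
Proof. by move=> j0; rewrite /dratio ltr_pdivlMr ?ltr0n// mul1r ltr_nat djpred. Qed.

Let dratioB1 j : (0 < j)%N ->
  dratio R d j - 1 = (d j - d j.-1)%N%:R / (d j.-1)%:R.
Proof.
move=> j0; rewrite natrB ?(ltnW (djpred j0))// mulrBl divff//.
by rewrite pnatr_eq0 -lt0n.
Qed.

(** Block by block [g] is compared with the constant sequence 1, whose block means are 1 and for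
    which the Schur bound applies. *)
Lemma Hbounded_of_blockmean g : (esup_from 1 (dratio R d) < +oo)%E ->
  (esup_from 1 (blockmean p d g) < +oo)%E -> Hbounded p gamma g.
Proof.
move=> /esup_fromP[rho hrho] /esup_fromP[S hS].
have rho1 : 1 <= rho by apply: le_trans (hrho 1%N isT); rewrite ltW ?dratio_gt1.
have S0 : 0 <= S by apply: le_trans (hS 1%N isT); exact: blockmean_ge0.
pose s := S `^ p^-1 * rho `^ 2.
have s0 : 0 <= s by rewrite mulr_ge0 ?powR_ge0.
pose C := hilbert_cst (gamma + p^-1) `^ (p - 1) * hilbert_cst (1 - gamma - p^-1).
have C0 : 0 <= C.
  rewrite mulr_ge0 ?powR_ge0// hilbert_cst_ge0//.
  by case/andP: gp => g1 g2; apply/andP; split; lra.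
apply: (@Hbounded_of_sum g (s * C `^ p^-1)); first by rewrite mulr_ge0 ?powR_ge0.
move=> b B B0 b0 bB N.
have one1 j : (0 < j)%N -> blockmean p d (fun=> 1%:C : R[i]) j = 1.
  move=> j0; rewrite /blockmean; under eq_bigr do rewrite cabs_real normr1 powR1.
  by rewrite sumr_const_nat mulVf// pnatr_eq0 -lt0n subn_gt0 djpred.
(* The exponent 2 exceeds both [1 - gamma] and [gamma], and the ratios are larger than 1. *)
have gr j : (0 < j)%N -> growth gamma d j <= rho `^ 2.
  move=> j0; have r1 := dratio_gt1 j0.
  have ip1 : p^-1 < 1 by rewrite invf_lt1.
  have [g1 g2] := andP gp.
  have r2 : dratio R d j `^ 2 <= rho `^ 2.
    by apply: ler_powR2r; rewrite ?hrho ?(ltW (lt_trans ltr01 r1)).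
  have ip0 : 0 < p^-1 by rewrite invr_gt0.
  rewrite ge_max; apply/andP; split; apply: le_trans r2; apply: ler_powR;
    rewrite ?(ltW r1)//; lra.
have := tailnorm_le_block (u := fun k => cabs (g k) * hsum gamma b k)
  (v := fun k => cabs (1%:C : R[i]) * hsum gamma b k) p0 s0 hd (ltn0Sn 0).
rewrite (_ : d 1.-1 = 1%N)// => hT.
apply: tailnorm_powR_le; rewrite ?mulr_ge0 ?powR_ge0//.
apply: le_trans (hT _) _ => [j j0|].
  apply: le_trans (block_le p1 gp hd hd0 g j0 b0 bB (one1 j j0)) _.
  rewrite ler_wpM2r//; first by rewrite sumr_ge0// => k _; exact: powR_ge0.
  apply: ler_powR2r => //; first by rewrite mulr_ge0 ?powR_ge0// le_max powR_ge0.
  apply: ler_pM; rewrite ?powR_ge0 ?gr ?le_max ?powR_ge0//.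
  by apply: ler_powR2r; rewrite ?invr_gt0 ?blockmean_ge0 ?hS.
apply: (@le_trans _ _ (s%:E * (C `^ p^-1 * B)%:E)%E); last by rewrite -EFinM mulrA.
apply: lee_pmul => //; first exact: poweR_ge0.
rewrite -[X in (_ <= (_ * X)%:E)%E](powRK p0 B0) -powRM ?powR_ge0//.
apply: tailnorm_le => // M.
have := sum_hsum_powR_le p1 gp b0 bB M; apply: le_trans.
by rewrite cabs_real normr1; under eq_bigr do rewrite mul1r.
Qed.

(** Let [|g| ^ p] equal the block length at each left end point and 0 elsewhere, so that all block
    means are 1. The single entry at [k = d j], tested with [D = d j], bounds
    [(d j.+1 - d j) / d j]. *)
Lemma dratio_bounded_of : (forall g, (esup_from 1 (blockmean p d g) < +oo)%E ->
  Hbounded p gamma g) -> (esup_from 1 (dratio R d) < +oo)%E.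
Proof.
move=> himp.
have dlt i j : (i < j)%N -> (d i < d j)%N by move=> ij; apply: leq_trans (hd i) (dmono ij).
have dge j : (j < d j)%N by elim: j => [|j IH]; rewrite ?hd0// (leq_ltn_trans IH).
(* As [i < d i], the range [i < k] contains every [i] with [d i = k]. *)
pose w k : R := \sum_(0 <= i < k) (if d i == k then (d i.+1 - d i)%N%:R else 0).
have w0 k : 0 <= w k by apply: sumr_ge0 => i _; case: ifP.
have wd j : w (d j) = (d j.+1 - d j)%N%:R.
  rewrite /w (bigD1_seq j) ?mem_index_iota ?dge ?iota_uniq//= eqxx big1 ?addr0// => i ij.
  case: ifP => // /eqP dij; case: (ltngtP i j) ij => // [/dlt|/dlt]; by rewrite dij ltnn.
have wn j k : (d j < k < d j.+1)%N -> w k = 0.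
  move=> /andP[jk kj]; rewrite /w big1// => i _; case: ifP => // /eqP dik.
  have := leqP i j; case=> [/dmono|/dmono] dd; move: jk kj; rewrite -dik.
    by rewrite ltnNge dd.
  by move=> _; rewrite ltnNge dd.
pose g k : R[i] := (w k `^ p^-1)%:C.
have gE k : cabs (g k) `^ p = w k by rewrite cabs_real ger0_norm ?powR_ge0// powRVK.
have /himp/Hbounded_sum[M [M0 hM]] : (esup_from 1 (blockmean p d g) < +oo)%E.
  apply: (@esup_from_lty _ 1) => -[//|j] _; rewrite /blockmean /=.
  under eq_bigr do rewrite gE.
  rewrite big_ltn// wd big_nat_cond big1 ?addr0; last by move=> k /andP[/wn].
  by rewrite mulVf// pnatr_eq0 -lt0n subn_gt0.
apply: (@esup_from_lty _ (1 + M `^ p / c `^ p)) => -[//|j] _.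
have [b [b0 b1 hb]] := test_sequence p1 pq gp (dpos j).
have cp : 0 < c `^ p by rewrite powR_gt0.
rewrite -lerBlDl dratioB1// ler_pdivlMr//.
apply: le_trans (hM b b0 b1 (d j).+1).
rewrite big_nat_recr//= -[leLHS]add0r lerD//.
  by rewrite sumr_ge0// => k _; exact: powR_ge0.
have h := hb (d j); rewrite dpos leqnn in h.
have Dp : 0 <= (d j)%:R `^ (- p^-1) * c by rewrite mulr_ge0 ?powR_ge0 ?(ltW c_gt0).
rewrite powRM ?cabs_ge0 ?(le_trans Dp (h isT))// gE wd -mulrA ler_wpM2l//.
apply: le_trans (ler_powR2r p0 Dp (h isT)).
by rewrite powRM ?powR_ge0 ?(ltW c_gt0)// powRNVK.
Qed.

(** The factor [(d j - d j.-1) / d j] of [block_lower] is 1 minus the inverse ratio, hence at least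
    [1 - 1/r]. *)
Lemma blockmean_bounded_of g : (1 < einf_from 1 (dratio R d))%E -> Hbounded p gamma g ->
  (esup_from 1 (blockmean p d g) < +oo)%E.
Proof.
move=> hinf /Hbounded_sum[M [M0 hM]].
have lb j : (0 < j)%N -> (einf_from 1 (dratio R d) <= (dratio R d j)%:E)%E.
  by move=> j0; apply: ereal_inf_lbound; exists j.
move: hinf lb; case: (einf_from _ _) => [r|_ /(_ 1%N isT)|//]; last by rewrite leye_eq.
rewrite lte_fin => r1 lb.
have r0 : 0 < r by apply: lt_trans r1.
have cp : 0 < c `^ p by rewrite powR_gt0.
have ir : 0 < 1 - r^-1 by rewrite subr_gt0 invf_lt1.
apply: (@esup_from_lty _ (M `^ p / ((1 - r^-1) * c `^ p))) => j j0.
have [b [b0 b1 hb]] := block_lower g j0.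
rewrite ler_pdivlMr ?mulr_gt0//.
have dj := djpred j0.
have hMj : \sum_(d j.-1 <= k < d j) (cabs (g k) * hsum gamma b k) `^ p <= M `^ p.
  apply: le_trans (hM b b0 b1 (d j)).
  rewrite [leRHS](big_cat_nat (dpos j.-1) (ltnW dj))/= lerDr.
  by rewrite sumr_ge0// => k _; exact: powR_ge0.
apply: le_trans (le_trans hb hMj); rewrite mulrA ler_wpM2r ?powR_ge0//.
rewrite ler_wpM2l ?blockmean_ge0// mulrBl divff; last by rewrite pnatr_eq0 -lt0n.
rewrite lerD2l lerN2 -invf_div lef_pV2 ?posrE ?(lt_trans ltr01 (dratio_gt1 j0))//.
by rewrite -lee_fin; exact: lb.
Qed.

End Boundedness.

(** * Weights on thin blocks: the necessity in (2) *)

Lemma sum_indicator_le (R : realType) (f : nat -> R) (l m n N : nat) :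
  (forall k, 0 <= f k) ->
  \sum_(l <= k < N) (if (m <= k < n)%N then f k else 0) <= \sum_(m <= k < n) f k.
Proof.
move=> f0; have i0 k : 0 <= (if (m <= k < n)%N then f k else 0) by case: ifP.
rewrite (big_nat_widenl m 0)// (big_nat_widen _ _ (N + n)) ?leq_addl//.
apply: (@le_trans _ _ (\sum_(0 <= k < N + n) (if (m <= k < n)%N then f k else 0))).
  rewrite [leRHS](big_cat_nat (leq0n N) (leq_addr n N))/= -[leLHS]addr0 lerD ?sumr_ge0//.
  have [lN|Nl] := leqP l N; last by rewrite big_geq ?sumr_ge0// ltnW.
  by rewrite [leRHS](big_cat_nat (leq0n l) lN)/= lerDr sumr_ge0.
rewrite -big_mkcond/= le_eqVlt; apply/orP; left; apply/eqP.
by apply: eq_bigl => k; rewrite andbC.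
Qed.

Section ThinBlocks.
Variable R : realType.
Variables (p gamma : R) (d : nat -> nat).
Hypotheses (p1 : 1 < p) (gp : - p^-1 < gamma < 1 - p^-1).
Hypotheses (hd : forall n, (d n < d n.+1)%N) (hd0 : d 0%N = 1%N).

Let p0 : 0 < p. Proof. exact: lt_trans ltr01 p1. Qed.

Let dpos j : (0 < d j)%N. Proof. exact: (block_start_gt0 hd hd0). Qed.

Let dgt j : (j < d j)%N.
Proof. by elim: j => [|j IH]; rewrite ?hd0// (leq_ltn_trans IH). Qed.

(** Every single ratio exceeds 1, so an infimum of at most 1 is approached along arbitrarily large
    indices: a tolerance below the excess of the ratio at [i.+1] excludes that index. *)
Lemma thin_blocks : ~ (1 < einf_from 1 (dratio R d))%E ->
  forall (i : nat) (e : R), 0 < e -> exists2 j, (i < j)%N & dratio R d j < 1 + e.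
Proof.
move=> hinf; elim=> [|i IH] e e0.
  apply: contrapT => hj; apply: hinf; apply: (@lt_le_trans _ _ (1 + e)%:E).
    by rewrite lte_fin ltrDl.
  apply: le_ereal_inf_tmp => _ [j j0 <-]; rewrite lee_fin leNgt; apply/negP => je.
  by apply: hj; exists j.
have r1 : 0 < dratio R d i.+1 - 1.
  by rewrite subr_gt0 /dratio ltr_pdivlMr ?ltr0n// mul1r ltr_nat hd.
have [|j ij je] := IH (Num.min e (dratio R d i.+1 - 1)); first by rewrite lt_min e0.
exists j; last by apply: lt_le_trans je _; rewrite lerD2l ge_min lexx.
rewrite ltn_neqAle ij andbT; apply: contraTneq je => <-.
by rewrite -leNgt -lerBrDl ge_min lexx orbT.
Qed.

Variable J : nat -> nat.
Hypothesis iJ : forall i, (i < J i)%N.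
Hypothesis thinJ : forall i, dratio R d (J i) < 1 + (4 ^- i).

Let inblock i k := (d (J i).-1 <= k < d (J i))%N.

(* [J] need not be injective. As [k] in block [J i] forces [i < k], this finite sum
   still sees every such [i]. *)
Definition thin_weight (k : nat) : R :=
  \sum_(0 <= i < k) (if inblock i k then 2 ^+ i else 0).

Let inblock_gt i k : inblock i k -> (i < k)%N.
Proof.
case/andP => ik _; apply: leq_trans ik; apply: leq_trans (dgt _).
by move: (iJ i); case: (J i).
Qed.

Lemma thin_weight_ge0 k : 0 <= thin_weight k.
Proof. by apply: sumr_ge0 => i _; case: ifP => // _; exact: exprn_ge0. Qed.

Let thin_weight_ge i k : inblock i k -> 2 ^+ i <= thin_weight k.
Proof.
move=> ik; have ilt := inblock_gt ik.
rewrite /thin_weight (bigD1_seq i) ?mem_index_iota ?iota_uniq//= ik lerDl.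
by apply: sumr_ge0 => l _; case: ifP => // _; exact: exprn_ge0.
Qed.

(** Block [J i] has relative length at most [4 ^- i] and carries the weight [2 ^ i], so it
    contributes at most [2 ^- i]. *)
Lemma sum_thin_weight_le N : \sum_(1 <= k < N) thin_weight k / k%:R <= 2.
Proof.
apply: (@le_trans _ _ (\sum_(0 <= i < N) \sum_(1 <= k < N)
    (if inblock i k then 2 ^+ i / k%:R else 0))).
  rewrite exchange_big/=; apply: ler_sum_nat => k /andP[k0 kN].
  rewrite /thin_weight mulr_suml [leRHS](big_cat_nat (leq0n k) (ltnW kN))/= -[leLHS]addr0.
  apply: lerD; last by apply: sumr_ge0 => i _; case: ifP => // _; rewrite divr_ge0 ?exprn_ge0.
  by apply: ler_sum => i _; case: ifP; rewrite ?mul0r.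
apply: (@le_trans _ _ (\sum_(0 <= i < N) (2^-1) ^+ i)); last first.
  have -> : \sum_(0 <= i < N) (2^-1) ^+ i = 2 * (1 - (2^-1) ^+ N) :> R.
    elim: N => [|N IH]; first by rewrite big_geq// expr0 subrr mulr0.
    by rewrite big_nat_recr//= IH exprS; field.
  by rewrite ler_piMr// gerBl exprn_ge0// invr_ge0.
apply: ler_sum => i _; set j := J i.
have j0 : (0 < j)%N by apply: leq_trans (iJ i).
have dj : (d j.-1 < d j)%N by rewrite -[in ltnRHS](prednK j0).
have D0 : 0 < ((d j.-1)%:R : R) by rewrite ltr0n.
apply: (@le_trans _ _ (\sum_(1 <= k < N) (if inblock i k then 2 ^+ i / (d j.-1)%:R else 0))).
  apply: ler_sum_nat => k /andP[k0 _]; case: ifP => // /andP[jk _].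
  by rewrite ler_wpM2l ?exprn_ge0// lef_pV2 ?posrE ?ltr0n// ler_nat.
apply: (@le_trans _ _ (\sum_(d j.-1 <= k < d j) 2 ^+ i / (d j.-1)%:R)).
  by apply: sum_indicator_le => k; rewrite divr_ge0 ?exprn_ge0.
rewrite sumr_const_nat -[leLHS]mulr_natl.
have := thinJ i; rewrite -/j /dratio => hj.
have {}hj : (d j - d j.-1)%N%:R / (d j.-1)%:R <= 4 ^- i :> R.
  by rewrite natrB ?(ltnW dj)// mulrBl divff ?gt_eqF// lerBlDl ltW.
rewrite mulrCA; apply: (le_trans (ler_wpM2l (exprn_ge0 i (ler0n _ 2)) hj)).
rewrite -exprVn -exprMn (_ : 2 / 4 = 2^-1 :> R)//.
by field.
Qed.

(** The p-th power of the modulus is the weight itself, and the decay [S_k ^ p <= C B ^ p / k]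
    leaves the summable [thin_weight k / k]. *)
Lemma thin_Hbounded : Hbounded p gamma (fun k => (thin_weight k `^ p^-1)%:C).
Proof.
pose C := hilbert_cst (gamma + p^-1) `^ (p - 1).
have C0 : 0 <= C by exact: powR_ge0.
apply: (@Hbounded_of_sum _ _ _ p1 gp _ ((C * 2) `^ p^-1)); first exact: powR_ge0.
move=> b B B0 b0 bB N.
rewrite powRM ?powR_ge0// powRVK ?mulr_ge0//.
apply: (@le_trans _ _ (\sum_(1 <= k < N) thin_weight k / k%:R * (C * B `^ p))).
  apply: ler_sum_nat => k /andP[k0 _].
  rewrite powRM ?cabs_ge0 ?(hsum_ge0 p1 gp b0 bB)// cabs_real ger0_norm ?powR_ge0//.
  rewrite powRVK ?thin_weight_ge0// -mulrA ler_wpM2l ?thin_weight_ge0//.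
  by apply: le_trans (hsum_powR_le p1 gp b0 bB k0) _; rewrite mulrCA mulrA.
rewrite -mulr_suml (_ : C * 2 * B `^ p = 2 * (C * B `^ p)); last by ring.
by apply: ler_wpM2r (sum_thin_weight_le N); rewrite mulr_ge0 ?powR_ge0.
Qed.

Lemma thin_blockmean i : 2 ^+ i <= blockmean p d (fun k => (thin_weight k `^ p^-1)%:C) (J i).
Proof.
have j0 : (0 < J i)%N by apply: leq_trans (iJ i).
have dj : (d (J i).-1 < d (J i))%N by rewrite -[in ltnRHS](prednK j0).
rewrite /blockmean mulrC ler_pdivlMr ?ltr0n ?subn_gt0// mulrC.
apply: sum_ge_const => k ik; rewrite cabs_real ger0_norm ?powR_ge0//.
by rewrite powRVK ?thin_weight_ge0// thin_weight_ge.
Qed.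

End ThinBlocks.

Lemma dratio_gap_of (R : realType) (p gamma : R) (d : nat -> nat) :
  1 < p -> - p^-1 < gamma < 1 - p^-1 ->
  (forall n, (d n < d n.+1)%N) -> d 0%N = 1%N ->
  (forall g : nat -> R[i], Hbounded p gamma g ->
     (esup_from 1 (blockmean p d g) < +oo)%E) ->
  (1 < einf_from 1 (dratio R d))%E.
Proof.
move=> p1 gp hd hd0 himp; apply: contrapT => /(thin_blocks hd hd0) thin.
have /choice[J hJ] i : exists j, (i < j)%N /\ dratio R d j < 1 + 4 ^- i.
  have [|j ij je] := thin i (4 ^- i); first by rewrite invr_gt0 exprn_gt0.
  by exists j.
have iJ i := (hJ i).1; have thinJ i := (hJ i).2.
have /himp/esup_fromP[B hB] := thin_Hbounded p1 gp hd hd0 iJ thinJ.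
have B0 : 0 <= B.
  apply: le_trans (hB (J 0%N) (iJ 0%N)); exact: blockmean_ge0.
(* The block with index parameter [truncn B + 1] has mean at least [2 ^ (truncn B + 1) > B]. *)
have := hB (J (Num.truncn B).+1) (leq_trans (ltn0Sn _) (ltnW (iJ _))).
apply/negP; rewrite -ltNge.
apply: lt_le_trans (thin_blockmean p1 hd hd0 iJ _).
apply: lt_le_trans (truncnS_gt B) _.
by rewrite -natrX ler_nat ltnW// ltn_expl.
Qed.

Theorem theorem1 (R : realType) (p p' gamma : R) (d : nat -> nat)
  (hp : 1 < p) (hpp' : p^-1 + p'^-1 = 1)
  (hgamma : - p^-1 < gamma < 1 - p^-1)
  (hd : forall n : nat, (d n < d n.+1)%N) (hd0 : d 0%N = 1%N) :
  (forall (g : nat -> R[i]) (K : nat), (0 < K)%N ->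
    (forall a ghat : nat -> R[i],
       in_lp p a ->
       (forall n : nat, (0 < n)%N -> 0 <= a n) ->
       (forall n : nat, (0 < n)%N -> blockmean p d ghat n = 1) ->
       (CK p gamma d K g a <=
          esup_from K (fun j =>
            (blockmean p d g j `^ p^-1 *
             Num.max (dratio R d j `^ (1 - gamma)) (dratio R d j `^ gamma))%R)
          * CK p gamma d K ghat a)%E)
    /\
    (ereal_sup [set CK p gamma d K g a | a in [set a | lpnorm p a = 1%E]] >=
       esup_from K (fun j =>
         (blockmean p d g j `^ p^-1 *
          (((d j)%:R - (d j.-1)%:R) / (d j)%:R) `^ p^-1)%R)
       * (\int[@lebesgue_measure R]_(x in `[3%R, +oo[%classic)
            ((x `^ (- (`|gamma| * p')) / (1 + x) `^ p')%R)%:E) `^ p'^-1)%E)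
  /\
  ((forall g : nat -> R[i],
      (esup_from 1 (blockmean p d g) < +oo)%E -> Hbounded p gamma g)
   <-> (esup_from 1 (dratio R d) < +oo)%E)
  /\
  ((forall g : nat -> R[i],
      Hbounded p gamma g -> (esup_from 1 (blockmean p d g) < +oo)%E)
   <-> (1 < einf_from 1 (dratio R d))%E).
Proof.
split; [|split; split].
- move=> g K K0; split=> [a h a_lp a0 h1|].
    exact: (CK_upper hp hgamma hd hd0).
  exact: (CK_lower hp hpp' hgamma hd hd0).
- exact: (dratio_bounded_of hp hpp' hgamma hd hd0).
- by move=> hr g; exact: (Hbounded_of_blockmean hp hgamma hd hd0).
- exact: (dratio_gap_of hp hgamma hd hd0).
- by move=> hi g; exact: (blockmean_bounded_of hp hpp' hgamma hd hd0).
Qed.
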